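(* Let $m\ge1$ be an integer and $\alpha>-1$ a real number with $\alpha-2m+1>0$. Let $v\in\mathcal{D}^{m,2}_\infty(\alpha)\cap C^{2m}(0,\infty)$ be a positive solution of $$(-\Delta_\alpha)^m v=|v|^{2^*-2}v\quad\text{in }(0,\infty)$$ which is $(2m-1)$-th nonsingular at $r=0$ and satisfies $v^{(i)}(0)=0$ for $i=1,3,\dots,2m-1$. Then $v=w_\epsilon$ for some $\epsilon>0$, where $$w_\epsilon(r)=\mathcal{P}^{\frac{\alpha-2m+1}{4m}}\left(\frac{\epsilon}{\epsilon^2+r^2}\right)^{\frac{\alpha-2m+1}{2}},\quad r>0,\qquad \mathcal{P}=\prod_{h=-m}^{m-1}(\alpha+1+2h).$$
   Context: $L^2_\theta$ is the space of measurable $u:(0,\infty)\to\mathbb{R}$ with $\|u\|_{L^2_\theta}=(\int_0^\infty|u|^2 r^\theta dr)^{1/2}<\infty$. $AC^{m-1}_{loc}(0,\infty)$ is the set of functions $u$ on $(0,\infty)$ having derivatives up to order $m-1$ with $u^{(m-1)}$ locally absolutely continuous. $\mathcal{D}^{m,2}_\infty(\alpha)$ is the completion of $\{u\in AC^{m-1}_{loc}(0,\infty): \lim_{r\to\infty}u^{(j)}(r)=0\ (0\le j\le m-1),\ u^{(m)}\in L^2_\alpha\}$ under the norm $\|u^{(m)}\|_{L^2_\alpha}$; since $\alpha-2m+1>0$, its elements are identified with functions in $AC^{m-1}_{loc}(0,\infty)$ with $u^{(j)}\in L^2_{\alpha-2(m-j)}$ for $0\le j\le m$. $\Delta_\alpha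 u=r^{-\alpha}(r^\alpha u')'=u''+\frac{\alpha}{r}u'$, and $2^*=\frac{2(\alpha+1)}{\alpha-2m+1}$. A function $u\in C^{2m}(0,\infty)$ is $\ell$-th nonsingular at $r=0$ if for each $0\le i\le\ell$ the (finite) limit $\lim_{r\to0^+}u^{(i)}(r)=:u^{(i)}(0)$ exists. *)

(* Defs.v *)
From HB Require Import structures.
From mathcomp Require Import all_boot all_order all_algebra.
From mathcomp Require Import all_classical all_reals all_analysis.
Set Implicit Arguments.
Unset Strict Implicit.
Unset Printing Implicit Defensive.
Import Order.TTheory GRing.Theory Num.Theory numFieldNormedType.Exports.
Local Open Scope ring_scope.
Local Open Scope classical_set_scope.

(** Functions on (0, oo) are total functions [R -> R] of which only the values
    on (0, oo) matter: [u^`(j)] at a positive point depends only on the germ of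
    [u] there. *)

Definition halfline (R : realType) : set R := `]0, +oo[%classic.
Arguments halfline R : clear implicits.

Definition wL2norm (R : realType) (theta : R) (u : R -> R) : \bar R :=
  ((\int[lebesgue_measure]_(r in halfline R) (`|u r| ^+ 2 * r `^ theta)%:E)
     `^ (2^-1)%R)%E.

Definition wL2dist (R : realType) (theta : R) (f g : R -> R) : \bar R :=
  wL2norm theta (fun r => f r - g r).

(** [measurable_fun] is Borel measurability. Every function this is applied to
    below is a derivative [u^`(j)] with [u^`(i)], [i < j], continuous, extended
    by a constant to the Borel null set where it fails to exist; for these, Borel
    and Lebesgue measurability amount to the same. *)
Definition in_wL2 (R : realType) (theta : R) (u : R -> R) : Prop :=
  measurable_fun (halfline R) u /\ (wL2norm theta u < +oo)%E.

Definition abs_continuous (R : realType) (a b : R) (f : R -> R) : Prop :=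
  forall e : R, 0 < e -> exists2 d : R, 0 < d &
    forall (n : nat) (x y : 'I_n -> R),
      (forall i, a <= x i /\ x i <= y i /\ y i <= b) ->
      (forall i j, i != j -> y i <= x j \/ y j <= x i) ->
      \sum_(i < n) (y i - x i) < d ->
      \sum_(i < n) `|f (y i) - f (x i)| < e.

Definition ACloc (R : realType) (k : nat) (u : R -> R) : Prop :=
  (forall (i : nat) (r : R), (i < k)%N -> 0 < r -> derivable (u^`(i)) r 1) /\
  (forall a b : R, 0 < a -> a < b -> abs_continuous a b (u^`(k))).

Definition Ck (R : realType) (k : nat) (u : R -> R) : Prop :=
  (forall (i : nat) (r : R), (i < k)%N -> 0 < r -> derivable (u^`(i)) r 1) /\
  (forall r : R, 0 < r -> {for r, continuous (u^`(k))}).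

Definition preD (R : realType) (m : nat) (alpha : R) (u : R -> R) : Prop :=
  [/\ ACloc m.-1 u,
      forall j : nat, (j < m)%N -> (u^`(j)) r @[r --> +oo] --> (0 : R)
    & in_wL2 alpha (u^`(m))].

(** An element of the completion of [preD m alpha] is given by a sequence [phi]
    that is Cauchy for [u |-> wL2norm alpha (u^`(m))]. By the weighted Hardy
    inequalities, [(phi n)^`(j)] is then Cauchy in the space of weight
    [alpha - 2 * (m - j)] for every [j <= m]; the function identified with that
    element is the one whose derivatives are the limits of these sequences. *)
Definition Dspace (R : realType) (m : nat) (alpha : R) (u : R -> R) : Prop :=
  [/\ ACloc m.-1 u,
      forall j : nat, (j <= m)%N ->
        in_wL2 (alpha - 2 * (m%:R - j%:R)) (u^`(j))
    & exists phi : nat -> R -> R,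
      [/\ forall n : nat, preD m alpha (phi n),
          forall e : R, 0 < e -> exists N : nat, forall k l : nat,
            (N <= k)%N -> (N <= l)%N ->
            (wL2dist alpha ((phi k)^`(m))%classic ((phi l)^`(m))%classic
               < e%:E)%E
        & forall j : nat, (j <= m)%N ->
            wL2dist (alpha - 2 * (m%:R - j%:R)) ((phi n)^`(j)) (u^`(j))
              @[n --> \oo] --> (0 : \bar R)%E]].

Definition Delta (R : realType) (alpha : R) (u : R -> R) (r : R) : R :=
  r `^ (- alpha) * derive1 (fun s : R => s `^ alpha * derive1 u s) r.

Definition polyDelta (R : realType) (m : nat) (alpha : R) (u : R -> R) : R -> R :=
  iter m (fun (f : R -> R) (r : R) => - Delta alpha f r) u.

Lemma DeltaE (R : realType) (alpha : R) (u : R -> R) (r : R) :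
  0 < r -> derivable (derive1 u) r 1 ->
  Delta alpha u r = derive1n 2 u r + alpha / r * derive1 u r.
Proof.
move=> r0 du.
have h1 := is_derive1_powR alpha r0.
have h2 : is_derive r (1 : R) (derive1 u) (derive1n 2 u r).
  exact: (DeriveDef du (esym (derive1E (derive1 u) r))).
rewrite /Delta derive1E (@derive_val _ _ _ _ _ _ _ (is_deriveM h1 h2)).
rewrite /GRing.scale /=.
move: (derive1 (derive1 u) r) (derive1 u r) => a b.
have D s t : r `^ s * r `^ t = r `^ (s + t).
  by rewrite powRD// (gt_eqF r0) implybT.
have key : r `^ (- alpha) * r `^ alpha = 1 by rewrite D addNr powRr0.
have key1 : r `^ (- alpha) * r `^ (alpha - 1) = r^-1.
  by rewrite D addrA addNr add0r powR_inv1// ltW.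
move: key key1.
move: (r `^ (- alpha)) (r `^ alpha) (r `^ (alpha - 1)) (r^-1) => x y z t h k.
by rewrite mulrDr mulrA h mul1r mulrCA [b * _]mulrC mulrCA k [alpha * t]mulrC.
Qed.

Definition crit_exp (R : realType) (m : nat) (alpha : R) : R :=
  2 * (alpha + 1) / (alpha - 2 * m%:R + 1).

Definition nonsingular0 (R : realType) (l : nat) (u : R -> R) : Prop :=
  forall i : nat, (i <= l)%N -> cvg ((u^`(i)) r @[r --> 0^'+]).

Definition deriv_at0 (R : realType) (u : R -> R) (i : nat) : R :=
  lim ((u^`(i)) r @[r --> 0^'+]).

Definition Pconst (R : realType) (m : nat) (alpha : R) : R :=
  (* index shift h = k - m *)
  \prod_(0 <= k < 2 * m) (alpha + 1 + 2 * (k%:R - m%:R)).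

Definition bubble (R : realType) (m : nat) (alpha eps : R) (r : R) : R :=
  Pconst m alpha `^ ((alpha - 2 * m%:R + 1) / (4 * m%:R)) *
  (eps / (eps ^+ 2 + r ^+ 2)) `^ ((alpha - 2 * m%:R + 1) / 2).

(* Main.v *)
Require Import Defs.
From HB Require Import structures.
From mathcomp Require Import all_boot all_order all_algebra.
From mathcomp Require Import all_classical all_reals all_analysis.
From mathcomp Require Import measurable_realfun ring lra zify.
Set Implicit Arguments.
Unset Strict Implicit.
Unset Printing Implicit Defensive.
Import Order.TTheory GRing.Theory Num.Theory numFieldNormedType.Exports.
Local Open Scope ring_scope.
Local Open Scope classical_set_scope.

(** Put N = alpha + 1 > 2m and p = 2^* - 1. Then Delta_alpha is the radial
    Laplacian in the real dimension N, for which there is no conformal group to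
    move a solution off the origin. The proof counts sign changes instead.

    Let V_i = (-Delta_alpha)^i v and let W_i = r^alpha V_i' be its flux, so that
    W_i' = - r^alpha V_(i+1) and V_m = v^p. Nonsingularity at 0 and
    alpha > 2m - 1 make every flux vanish at 0 ([polyflux_cvg0]). If some V_i
    with V_(i+1) >= 0 did not decrease to 0, then V_(i-1), ..., V_0 would stay
    away from 0 at infinity, against the integrability of v^2 r^(alpha - 2m);
    so all the V_i are nonnegative, decreasing and vanish at infinity
    ([chain_nonneg_decay]). An explicit computation gives the same structure to
    the bubble w_eps ([bubble_chain], [bubble_solves]). Choose eps so that
    w_eps(0) = v(0), let d = v - w_eps and X_i = (-Delta_alpha)^i d.

    If d takes n >= 1 alternating signs, then, as d vanishes at 0 and at
    infinity, d' takes n + 1 alternating signs by Rolle's theorem. The levels X_i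
    vanish at infinity and their fluxes at 0, so none of the further
    differentiations loses a sign change, and X_m = v^p - w_eps^p takes n + 1
    alternating signs ([chain_alternates_gain]). But X_m has the sign of d. Hence
    d takes n + 1 alternating signs, and then arbitrarily many.

    This is impossible unless d = 0 ([finite_alternations]). On a short interval,
    or near 0, many sign changes of d give sign changes of all the X_i and of
    their fluxes; integrating 2m times from these points bounds d by a small
    multiple of itself, because |X_m| <= L |d|. Near infinity the same integration
    is carried out from infinity, where |X_m| is small compared with r^(-2m) |d|;
    this rests on a decay rate of v close to the optimal r^(2m - N)
    ([critical_decay]), which is obtained by comparing v with explicit chains of
    powers. *)

(** * Increments and limits on the half-line *)

Lemma mvt_pos (R : realType) (f df : R -> R) (a b : R) :
  0 < a -> a < b -> (forall x : R, 0 < x -> is_derive x (1 : R) f (df x)) ->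
  exists c, [/\ a < c, c < b & f b - f a = df c * (b - a)].
Proof.
move=> a0 ab fd; have [||c] := @MVT R f df a b ab.
- by move=> x; rewrite in_itv /= => /andP[ax _]; apply: fd; exact: lt_trans ax.
- apply: derivable_within_continuous => x; rewrite in_itv /= => /andP[ax _].
  by have [] := fd x (lt_le_trans a0 ax).
- by rewrite in_itv /= => /andP[ac cb] h; exists c.
Qed.

(** Stands in for integration: a bound on f' is integrated by exhibiting an
    explicit primitive g of the bound. *)
Lemma increment_le (R : realType) (f df g dg : R -> R) (a b : R) :
  0 < a -> a <= b -> (forall x : R, 0 < x -> is_derive x (1 : R) f (df x)) ->
  (forall x : R, 0 < x -> is_derive x (1 : R) g (dg x)) ->
  (forall x, a < x -> x < b -> df x <= dg x) -> f b - f a <= g b - g a.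
Proof.
move=> a0; rewrite le_eqVlt => /predU1P[<- *|ab fd gd fg]; first by rewrite !subrr.
have [|c [ac cb]] := @mvt_pos R (fun x => g x - f x) (fun x => dg x - df x) a b a0 ab.
  by move=> x x0; exact: is_deriveB (gd x x0) (fd x x0).
move=> h; have := fg c ac cb; rewrite -subr_ge0 => h2.
have : 0 <= (dg c - df c) * (b - a) by rewrite mulr_ge0// subr_ge0 ltW.
by rewrite -h; lra.
Qed.

Lemma increment_abs_le (R : realType) (f df g dg : R -> R) (a b : R) :
  0 < a -> a <= b -> (forall x : R, 0 < x -> is_derive x (1 : R) f (df x)) ->
  (forall x : R, 0 < x -> is_derive x (1 : R) g (dg x)) ->
  (forall x, a < x -> x < b -> `|df x| <= dg x) -> `|f b - f a| <= g b - g a.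
Proof.
move=> a0 ab fd gd fg; rewrite ler_norml; apply/andP; split; last first.
  apply: increment_le fd gd _ => // x ax xb.
  exact: le_trans (ler_norm _) (fg x ax xb).
have : (fun x => - f x) b - (fun x => - f x) a <= g b - g a.
  apply: (@increment_le R (fun x => - f x) (fun x => - df x) g dg) => // x.
    by move=> x0; exact: is_deriveN (fd x x0).
  by move=> ax xb; rewrite (le_trans _ (fg x ax xb))// -normrN ler_norm.
by rewrite /=; lra.
Qed.

Lemma is_derive_cpow (R : realType) (c s x : R) : 0 < x ->
  is_derive x (1 : R) (fun r => c * r `^ s) (c * (s * x `^ (s - 1))).
Proof. by move=> x0; exact: is_deriveZ (is_derive1_powR s x0). Qed.

Lemma is_derive_lin (R : realType) (c x : R) :
  is_derive x (1 : R) (fun r => c * r) c.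
Proof.
apply: (is_derive_eq (is_deriveZ c (is_derive_id x (1 : R)))).
by rewrite scaler1.
Qed.

Lemma powRD_pos (R : realType) (x s t : R) : 0 < x ->
  x `^ (s + t) = x `^ s * x `^ t.
Proof. by move=> x0; rewrite powRD// (gt_eqF x0) implybT. Qed.

Lemma powRVK (R : realType) (x s : R) : 0 < x -> x `^ (- s) * x `^ s = 1.
Proof. by move=> x0; rewrite -powRD_pos// addNr powRr0. Qed.

Lemma cvg_pinftyP (R : realType) (f : R -> R) :
  f r @[r --> +oo] --> (0 : R) <->
  forall e, 0 < e -> exists2 T, 0 < T & forall x, T <= x -> `|f x| < e.
Proof.
split=> [/cvgrPdist_lt f0 e e0|h].
  have [M [_ hM]] := f0 e e0; exists (Num.max (M + 1) 1).
    by rewrite lt_max ltr01 orbT.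
  move=> x; rewrite ge_max => /andP[Mx _].
  have /hM : M < x by rewrite (lt_le_trans _ Mx)// ltrDl.
  by rewrite sub0r normrN.
apply/cvgrPdist_lt => e e0; have [T T0 hT] := h e e0.
exists T; split; first exact: num_real.
by move=> x Tx; rewrite sub0r normrN hT// ltW.
Qed.

Lemma cvg_right0P (R : realType) (f : R -> R) (l : R) :
  f r @[r --> 0^'+] --> l <->
  forall e, 0 < e -> exists2 d, 0 < d & forall x, 0 < x -> x < d -> `|f x - l| < e.
Proof.
split=> [/cvgrPdist_lt f0 e e0|h].
  have [d d0 hd] := f0 e e0; exists d => // x x0 xd.
  by rewrite distrC; apply: hd => //=; rewrite sub0r normrN gtr0_norm.
apply/cvgrPdist_lt => e e0; have [d d0 hd] := h e e0.
exists d => // x /=; rewrite sub0r normrN => xd x0.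
by rewrite distrC hd// -(gtr0_norm x0).
Qed.

Lemma exists_half_pow_lt (R : realType) (x e : R) : 0 <= x -> 0 < e ->
  exists n, x / 2 ^+ n < e.
Proof.
move=> x0 e0; exists (Num.bound (x / e)); rewrite ltr_pdivrMr ?exprn_gt0//.
rewrite mulrC -ltr_pdivrMr//; apply: lt_le_trans (archi_boundP _) _.
  by rewrite divr_ge0// ltW.
by rewrite -natrX ler_nat ltnW// ltn_expl.
Qed.

Lemma cvg_right0_point (R : realType) (f : R -> R) (l e r : R) :
  f r @[r --> 0^'+] --> l -> 0 < e -> 0 < r ->
  exists x, [/\ 0 < x, x < r & `|f x - l| < e].
Proof.
move=> /cvg_right0P fl e0 r0; have [d d0 hd] := fl e e0.
have x0 : 0 < Num.min (d / 2) (r / 2) by rewrite lt_min !divr_gt0.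
have half (y : R) : 0 < y -> y / 2 < y by lra.
exists (Num.min (d / 2) (r / 2)); split=> //; first by rewrite gt_min half ?orbT.
by apply: hd; rewrite // gt_min half.
Qed.

(** * Iterated radial Laplacians as first-order systems *)

(** The equation - Delta_alpha u = z as a first-order system for u and its
    flux w = r^alpha u'. *)
Definition radial_step (R : realType) (alpha : R) (u w z : R -> R) : Prop :=
  forall r : R, 0 < r -> is_derive r (1 : R) u (r `^ (- alpha) * w r) /\
    is_derive r (1 : R) w (- (r `^ alpha * z r)).

Definition radial_chain (R : realType) (m : nat) (alpha : R)
    (U W : nat -> R -> R) : Prop :=
  forall i : nat, (i < m)%N -> radial_step alpha (U i) (W i) (U i.+1).

Lemma radial_step_comb (R : realType) (alpha a b : R) (u w z u' w' z' : R -> R) :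
  radial_step alpha u w z -> radial_step alpha u' w' z' ->
  radial_step alpha (fun r => a * u r + b * u' r)
    (fun r => a * w r + b * w' r) (fun r => a * z r + b * z' r).
Proof.
move=> h h' r r0; have [h1 h2] := h r r0; have [h1' h2'] := h' r r0; split.
- apply: is_derive_eq (is_deriveD (is_deriveZ a h1) (is_deriveZ b h1')) _.
  by rewrite /GRing.scale /=; ring.
- apply: is_derive_eq (is_deriveD (is_deriveZ a h2) (is_deriveZ b h2')) _.
  by rewrite /GRing.scale /=; ring.
Qed.

Lemma radial_step_scale (R : realType) (alpha a : R) (u w z : R -> R) :
  radial_step alpha u w z ->
  radial_step alpha (fun r => a * u r) (fun r => a * w r) (fun r => a * z r).
Proof.
move=> h r r0; have [h1 h2] := h r r0; split.
- by apply: is_derive_eq (is_deriveZ a h1) _; rewrite /GRing.scale /=; ring.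
- by apply: is_derive_eq (is_deriveZ a h2) _; rewrite /GRing.scale /=; ring.
Qed.

(** The flux decreases from its value 0 at the origin. *)
Lemma flux_nonpos (R : realType) (alpha : R) (u w z : R -> R) :
  radial_step alpha u w z -> w r @[r --> 0^'+] --> (0 : R) ->
  (forall r, 0 < r -> 0 <= z r) -> forall r, 0 < r -> w r <= 0.
Proof.
move=> h w0 z0 r r0; rewrite leNgt; apply/negP => wr.
have [x [x0 xr]] := cvg_right0_point w0 wr r0; rewrite subr0 => wx.
have [|c [xc _ e]] := @mvt_pos R w (fun r => - (r `^ alpha * z r)) x r x0 xr.
  by move=> y y0; have [] := h y y0.
have c0 : 0 < c := lt_trans x0 xc.
have : 0 <= c `^ alpha * z c * (r - x).
  by rewrite !mulr_ge0 ?powR_ge0 ?z0// subr_ge0 ltW.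
have := ler_norm (w x); lra.
Qed.

Lemma radial_decr (R : realType) (alpha : R) (u w z : R -> R) :
  radial_step alpha u w z -> w r @[r --> 0^'+] --> (0 : R) ->
  (forall r, 0 < r -> 0 <= z r) -> forall x y, 0 < x -> x <= y -> u y <= u x.
Proof.
move=> h w0 z0 x y x0; rewrite le_eqVlt => /predU1P[->//|xy].
have [|c [xc _ e]] := @mvt_pos R u (fun r => r `^ (- alpha) * w r) x y x0 xy.
  by move=> r r0; have [] := h r r0.
have c0 : 0 < c := lt_trans x0 xc.
have : 0 <= c `^ (- alpha) * - w c * (y - x).
  by rewrite !mulr_ge0 ?powR_ge0 ?oppr_ge0 ?(flux_nonpos h)// subr_ge0 ltW.
lra.
Qed.

(** Maximum principle: u decreases to its limit 0. *)
Lemma radial_nonneg (R : realType) (alpha : R) (u w z : R -> R) :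
  radial_step alpha u w z -> w r @[r --> 0^'+] --> (0 : R) ->
  u r @[r --> +oo] --> (0 : R) ->
  (forall r, 0 < r -> 0 <= z r) -> forall r, 0 < r -> 0 <= u r.
Proof.
move=> h w0 /cvg_pinftyP uoo z0 r r0; rewrite leNgt; apply/negP => ur.
have [|T T0 hT] := uoo (- u r); first by rewrite oppr_gt0.
have rx : r <= Num.max r T by rewrite le_max lexx.
have /hT : T <= Num.max r T by rewrite le_max lexx orbT.
have := radial_decr h w0 z0 r0 rx; set x := u (Num.max r T) => xr.
have := ler_norm (- x); rewrite normrN; lra.
Qed.

Lemma chain_nonneg (R : realType) (m : nat) (alpha : R) (U W : nat -> R -> R) :
  radial_chain m alpha U W ->
  (forall i, (i < m)%N -> W i r @[r --> 0^'+] --> (0 : R)) ->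
  (forall i, (i < m)%N -> U i r @[r --> +oo] --> (0 : R)) ->
  (forall r, 0 < r -> 0 <= U m r) ->
  forall i, (i <= m)%N -> forall r, 0 < r -> 0 <= U i r.
Proof.
move=> hU W0 Uoo Um i im; rewrite -(subKn im).
elim: (m - i)%N (leq_subr i m) => [|k IH] km; first by rewrite subn0.
have km' : (m - k.+1 < m)%N by lia.
apply: (radial_nonneg (hU _ km') (W0 _ km') (Uoo _ km')).
by rewrite -subSn// subSS; apply: IH; exact: ltnW.
Qed.

(** The flux is at most a constant minus c r^(alpha+1) / (alpha+1), hence
    u' = r^(-alpha) w <= -1 far out. *)
Lemma radial_blowup (R : realType) (alpha c T : R) (u w z : R -> R) :
  0 < alpha -> 0 < c -> 0 < T ->
  radial_step alpha u w z -> (forall r, T <= r -> c <= z r) ->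
  exists2 T', 0 < T' & forall r, T' <= r -> u r <= - 1.
Proof.
move=> a0 c0 T0 h zc; have a1 : 0 < alpha + 1 by lra.
have dp (k x : R) : 0 < x ->
    is_derive x (1 : R) (fun r => k / (alpha + 1) * r `^ (alpha + 1)) (k * x `^ alpha).
  move=> x0; apply: is_derive_eq (is_derive_cpow (k / (alpha + 1)) (alpha + 1) x0) _.
  by rewrite addrK; field; lra.
have hw r : T <= r -> w r <= w T + c / (alpha + 1) * T `^ (alpha + 1)
    - c / (alpha + 1) * r `^ (alpha + 1).
  move=> Tr.
  have := @increment_le R w (fun x => - (x `^ alpha * z x)) _ _ T r T0 Tr
    (fun x x0 => (h x x0).2) (dp (- c)).
  suff H : forall x, T < x -> x < r -> - (x `^ alpha * z x) <= - c * x `^ alpha.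
    by move=> /(_ H); rewrite !mulNr; lra.
  move=> x Tx _; rewrite mulNr lerN2 mulrC ler_wpM2l ?powR_ge0//; apply: zc; exact: ltW.
set K := w T + _ in hw.
(* beyond T1, with r >= 1 and |K| + 1 <= c r / (alpha + 1), the bound hw gives
   w <= - r^alpha *)
pose T1 := Num.max (Num.max T 1) ((`|K| + 1) * (alpha + 1) / c).
have T11 : 1 <= T1 by rewrite !le_max lexx orbT.
have T1T : T <= T1 by rewrite !le_max lexx.
have T10 : 0 < T1 := lt_le_trans ltr01 T11.
have hu r : T1 <= r -> u r <= u T1 - (r - T1).
  move=> T1r.
  have := @increment_le R u (fun x => x `^ (- alpha) * w x) (fun x => -1 * x) (fun=> -1)
    T1 r T10 T1r (fun x x0 => (h x x0).1) (fun x _ => is_derive_lin _ _).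
  suff H : forall x, T1 < x -> x < r -> x `^ (- alpha) * w x <= -1.
    by move=> /(_ H); lra.
  move=> x T1x _; have x0 : 0 < x by lra.
  have x1 : 1 <= x by lra.
  have := hw x (ltW (le_lt_trans T1T T1x)).
  have : (`|K| + 1) * (alpha + 1) / c <= x.
    by rewrite (le_trans _ (ltW T1x))// /T1 le_max lexx orbT.
  rewrite ler_pdivrMr// => Kx wx.
  have xa : 1 <= x `^ alpha by rewrite -(powRr0 x) ler_powR// ltW.
  have e : x `^ (alpha + 1) = x * x `^ alpha.
    by rewrite powRD_pos// powRr1 ?ltW// mulrC.
  rewrite mulrC powRN ler_pdivrMr; last by rewrite powR_gt0.
  apply: (le_trans wx); rewrite e.
  have Kx' : `|K| + 1 <= c / (alpha + 1) * x.
    by rewrite mulrAC ler_pdivlMr// [c * x]mulrC.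
  have : (`|K| + 1) * x `^ alpha <= c / (alpha + 1) * x * x `^ alpha.
    by rewrite ler_wpM2r// powR_ge0.
  have : `|K| * 1 <= `|K| * x `^ alpha by rewrite ler_wpM2l.
  have := ler_norm K; lra.
exists (T1 + `|u T1| + 1) => [|r hr]; first by have := normr_ge0 (u T1); lra.
have n0 := normr_ge0 (u T1).
have /hu : T1 <= r by lra.
have := ler_norm (u T1); lra.
Qed.

(** By [radial_blowup] the lower levels leave every bounded set, with a sign
    that changes at each step; the multiplier s' keeps track of it. *)
Lemma chain_blowup (R : realType) (m : nat) (alpha : R) (U W : nat -> R -> R) :
  0 < alpha -> radial_chain m alpha U W ->
  forall i, (i <= m)%N -> forall s c T : R, 0 < c -> 0 < T ->
  (forall r, T <= r -> c <= s * U i r) ->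
  exists2 b, 0 < b & exists T' s', [/\ 0 < T', `|s'| <= `|s| &
     forall r, T' <= r -> b <= s' * U 0%N r].
Proof.
move=> a0 hU; elim=> [|i IH] im s c T c0 T0 h.
  by exists c => //; exists T, s; split.
have [T' T'0 hT'] := radial_blowup a0 c0 T0 (radial_step_scale s (hU i im)) h.
have [|b b0 [T2 [s2 [T20 hs h2]]]] := IH (ltnW im) (- s) 1 T' ltr01 T'0.
  by move=> r /hT'; rewrite mulNr; lra.
by exists b => //; exists T2, s2; split => //; rewrite normrN in hs.
Qed.

(** * Sign alternations and Rolle's theorem *)

(** Points x_1 < ... < x_n above a, all in P, at which s f is positive, negative,
    positive and so on. Sign changes are recorded by such points rather than by
    zeros because f may vanish on whole intervals. *)
Fixpoint alternates (R : realType) (P : R -> Prop) (f : R -> R) (s : R)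
    (n : nat) (a : R) : Prop :=
  if n is k.+1 then
    exists x, [/\ a < x, P x, 0 < s * f x & alternates P f (- s) k x]
  else True.

Lemma alternates_start (R : realType) (P : R -> Prop) (f : R -> R) s n (a b : R) :
  a <= b -> alternates P f s n b -> alternates P f s n a.
Proof.
case: n => //= n ab [x [bx Px sx h]]; exists x; split => //.
exact: le_lt_trans bx.
Qed.

Lemma alternates_prefix (R : realType) (P : R -> Prop) (f : R -> R) s k n (a : R) :
  (k <= n)%N -> alternates P f s n a -> alternates P f s k a.
Proof.
elim: k n s a => [//|k IH] [//|n] s a kn /= [x [ax Px sx h]].
by exists x; split => //; exact: IH h.
Qed.

Lemma alternates_sign (R : realType) (P : R -> Prop) (f g : R -> R) t s n (a : R) :
  (forall x s', a < x -> P x -> 0 < s' * f x -> 0 < t * s' * g x) ->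
  alternates P f s n a -> alternates P g (t * s) n a.
Proof.
elim: n s a => [//|n IH] s a fg /= [x [ax Px sx h]].
exists x; split => //; first exact: fg.
rewrite -mulrN; apply: IH h => y s' xy; apply: fg; exact: lt_trans xy.
Qed.

Lemma alternates2 (R : realType) (P : R -> Prop) (f : R -> R) s (a : R) :
  alternates P f s 2 a -> exists z z',
    [/\ a < z, P z, 0 < f z & [/\ a < z', P z' & f z' < 0]].
Proof.
move=> /= [x [ax Px sx [y [xy Py sy _]]]]; have ay := lt_trans ax xy.
have [s0|s0|s0] := ltgtP s 0; last by move: sx; rewrite s0 mul0r ltxx.
- exists y, x; split => //.
    by move: sy; rewrite pmulr_rgt0// oppr_gt0.
  by split => //; move: sx; rewrite nmulr_rgt0.
- exists x, y; split => //; first by move: sx; rewrite pmulr_rgt0.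
  by split => //; move: sy; rewrite mulNr oppr_gt0 pmulr_rlt0.
Qed.

Lemma mean_value_sign (R : realType) (f df : R -> R) (s x y : R) :
  0 < x -> x < y -> (forall x : R, 0 < x -> is_derive x (1 : R) f (df x)) ->
  s * f x < s * f y -> exists c, [/\ x < c, c < y & 0 < s * df c].
Proof.
move=> x0 xy fd sxy; have [c [xc cy e]] := mvt_pos x0 xy fd.
exists c; split => //; have : 0 < s * df c * (y - x) by rewrite -mulrA -e; lra.
by rewrite pmulr_lgt0// subr_gt0.
Qed.

(** The first point x is kept as a parameter so that the induction can place each
    new point after the previous one. *)
Lemma alternates_rolle_from (R : realType) (P : R -> Prop) (f df : R -> R) s n (x : R) :
  (forall x y, y <= x -> P x -> P y) ->
  (forall x : R, 0 < x -> is_derive x (1 : R) f (df x)) ->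
  0 < x -> 0 < s * f x ->
  alternates P f (- s) n x -> alternates P df (- s) n x.
Proof.
move=> dn fd; elim: n s x => [//|n IH] s x x0 sx /= [y [xy Py sy h]].
have y0 := lt_trans x0 xy.
have [|c [xc cy dc]] := @mean_value_sign R f df (- s) x y x0 xy fd.
  by move: sx sy; rewrite !mulNr; lra.
exists c; split => //; first exact: dn (ltW cy) Py.
by apply: (alternates_start (ltW cy)); exact: IH h.
Qed.

Lemma alternates_rolle (R : realType) (P : R -> Prop) (f df : R -> R) s n (a : R) :
  (forall x y, y <= x -> P x -> P y) ->
  (forall x : R, 0 < x -> is_derive x (1 : R) f (df x)) -> 0 <= a ->
  alternates P f s n.+1 a -> alternates P df (- s) n a.
Proof.
move=> dn fd a0 /= [x [ax Px sx h]]; apply: (alternates_start (ltW ax)).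
by apply: alternates_rolle_from h => //; exact: le_lt_trans ax.
Qed.

Lemma alternates_rolle_pinfty_from (R : realType) (f df : R -> R) s n (x : R) :
  (forall x : R, 0 < x -> is_derive x (1 : R) f (df x)) ->
  f r @[r --> +oo] --> (0 : R) -> 0 < x -> 0 < s * f x ->
  alternates (fun=> True) f (- s) n x -> alternates (fun=> True) df (- s) n.+1 x.
Proof.
move=> fd foo; elim: n s x => [|n IH] s x x0 sx.
  move=> _ /=; have s0 : s != 0 by apply: contraTneq sx => ->; rewrite mul0r ltxx.
  have e0 : 0 < s * f x / `|s| by rewrite divr_gt0// normr_gt0.
  have [T T0 hT] := (cvg_pinftyP f).1 foo _ e0.
  pose y := Num.max (x + 1) T.
  have xy : x < y by rewrite lt_max ltrDl ltr01.
  have /hT : T <= y by rewrite le_max lexx orbT.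
  rewrite ltr_pdivlMr ?normr_gt0// -normrM [f y * s]mulrC => fy.
  have [|c [xc cy dc]] := @mean_value_sign R f df (- s) x y x0 xy fd.
    by have := ler_norm (s * f y); rewrite !mulNr; lra.
  by exists c; split.
move=> [y [xy _ sy h]]; have y0 := lt_trans x0 xy.
have [|c [xc cy dc]] := @mean_value_sign R f df (- s) x y x0 xy fd.
  by move: sx sy; rewrite !mulNr; lra.
exists c; split => //.
by apply: (alternates_start (ltW cy)); exact: IH h.
Qed.

(** The return to 0 at infinity makes up for the alternation that Rolle's theorem
    loses. *)
Lemma alternates_rolle_pinfty (R : realType) (f df : R -> R) s n :
  (forall x : R, 0 < x -> is_derive x (1 : R) f (df x)) ->
  f r @[r --> +oo] --> (0 : R) ->
  alternates (fun=> True) f s n 0 -> alternates (fun=> True) df (- s) n 0.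
Proof.
case: n => [//|n] fd foo [x [x0 _ sx h]]; apply: (alternates_start (ltW x0)).
exact: alternates_rolle_pinfty_from h.
Qed.

Lemma rise_from_zero (R : realType) (f df : R -> R) (s x : R) :
  (forall x : R, 0 < x -> is_derive x (1 : R) f (df x)) ->
  f r @[r --> 0^'+] --> (0 : R) -> 0 < x -> 0 < s * f x ->
  exists c, [/\ 0 < c, c < x & 0 < s * df c].
Proof.
move=> fd f0 x0 sx.
have s0 : s != 0 by apply: contraTneq sx => ->; rewrite mul0r ltxx.
have e0 : 0 < s * f x / `|s| by rewrite divr_gt0// normr_gt0.
have [y [y0 yx]] := cvg_right0_point f0 e0 x0.
rewrite subr0 ltr_pdivlMr ?normr_gt0// -normrM [f y * s]mulrC => fy.
have [|c [yc cx dc]] := @mean_value_sign R f df s y x y0 yx fd.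
  by have := ler_norm (s * f y); lra.
by exists c; split => //; exact: lt_trans yc.
Qed.

(** Here the start from 0 makes up for it. *)
Lemma alternates_rolle_zero (R : realType) (f df : R -> R) s n :
  (forall x : R, 0 < x -> is_derive x (1 : R) f (df x)) ->
  f r @[r --> 0^'+] --> (0 : R) ->
  alternates (fun=> True) f s n 0 -> alternates (fun=> True) df s n 0.
Proof.
case: n => [//|n] fd f0 [x [x0 _ sx h]].
have [c [c0 cx dc]] := rise_from_zero fd f0 x0 sx.
exists c; split => //; apply: (alternates_start (ltW cx)).
exact: alternates_rolle_from h.
Qed.

(** Starting from 0 and returning to 0 gain one alternation. *)
Lemma alternates_rolle_both (R : realType) (f df : R -> R) s n :
  (forall x : R, 0 < x -> is_derive x (1 : R) f (df x)) ->
  f r @[r --> 0^'+] --> (0 : R) -> f r @[r --> +oo] --> (0 : R) ->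
  alternates (fun=> True) f s n.+1 0 -> alternates (fun=> True) df s n.+2 0.
Proof.
move=> fd f0 foo [x [x0 _ sx h]].
have [c [c0 cx dc]] := rise_from_zero fd f0 x0 sx.
exists c; split => //; apply: (alternates_start (ltW cx)).
exact: alternates_rolle_pinfty_from h.
Qed.

Lemma flux_alternates (R : realType) (P : R -> Prop) (alpha : R)
    (w : R -> R) s n (a : R) : 0 <= a ->
  alternates P (fun r => r `^ (- alpha) * w r) s n a -> alternates P w s n a.
Proof.
move=> a0; rewrite -{2}[s]mul1r; apply: alternates_sign => x s' ax _.
by rewrite mul1r mulrCA pmulr_rgt0// powR_gt0// (le_lt_trans a0).
Qed.

Lemma next_alternates (R : realType) (P : R -> Prop) (alpha : R)
    (z : R -> R) s n (a : R) : 0 <= a ->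
  alternates P (fun r => - (r `^ alpha * z r)) s n a -> alternates P z (- s) n a.
Proof.
move=> a0; rewrite -[- s]mulN1r; apply: alternates_sign => x s' ax _ h.
rewrite -(pmulr_rgt0 _ (powR_gt0 alpha (le_lt_trans a0 ax))).
suff -> : x `^ alpha * (-1 * s' * z x) = s' * - (x `^ alpha * z x) by [].
by ring.
Qed.

(** From U 0 to its flux one alternation is gained. After that a flux is
    differentiated with the help of its zero at 0 and a level with the help of its
    zero at infinity, so nothing is lost. *)
Lemma chain_alternates_gain (R : realType) (m : nat) (alpha : R)
    (U W : nat -> R -> R) s n :
  radial_chain m alpha U W ->
  (forall i, (i < m)%N -> W i r @[r --> 0^'+] --> (0 : R)) ->
  (forall i, (i < m)%N -> U i r @[r --> +oo] --> (0 : R)) ->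
  U 0%N r @[r --> 0^'+] --> (0 : R) -> (0 < m)%N ->
  alternates (fun=> True) (U 0%N) s n.+1 0 ->
  alternates (fun=> True) (U m) (- s) n.+2 0.
Proof.
move=> hU W0 Uoo U0 m0 h; case: m m0 hU W0 Uoo => // m _ hU W0 Uoo.
have dU i (im : (i < m.+1)%N) r (r0 : 0 < r) := (hU i im r r0).1.
have dW i (im : (i < m.+1)%N) r (r0 : 0 < r) := (hU i im r r0).2.
have next i s' k : (i < m.+1)%N -> alternates (fun=> True) (W i) s' k 0 ->
    alternates (fun=> True) (U i.+1) (- s') k 0.
  move=> im h'; apply: (next_alternates (lexx 0)).
  exact: alternates_rolle_zero (dW i im) (W0 i im) h'.
suff claim i : (i < m.+1)%N -> alternates (fun=> True) (U i.+1) (- s) n.+2 0.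
  exact: claim.
elim: i => [|i IH] im.
  apply: next => //; apply: (flux_alternates (lexx 0)).
  exact: alternates_rolle_both (dU _ im) U0 (Uoo _ im) h.
rewrite -[- s]opprK; apply: next => //.
apply: (flux_alternates (lexx 0)).
by apply: alternates_rolle_pinfty (dU _ im) (Uoo _ im) _; apply: IH; exact: ltnW.
Qed.

Lemma radial_alternates_flux (R : realType) (P : R -> Prop) (alpha : R)
    (u w z : R -> R) s n (a : R) :
  (forall x y, y <= x -> P x -> P y) -> radial_step alpha u w z -> 0 <= a ->
  alternates P u s n.+1 a -> alternates P w (- s) n a.
Proof.
move=> dn h a0 hu; apply: (flux_alternates (alpha := alpha) a0).
by apply: alternates_rolle hu => // r r0; have [] := h r r0.
Qed.

(** With no information at the ends, each differentiation costs one alternation. *)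
Lemma chain_alternates_loss (R : realType) (P : R -> Prop) (m : nat) (alpha : R)
    (U W : nat -> R -> R) s n (a : R) i :
  (forall x y, y <= x -> P x -> P y) -> radial_chain m alpha U W -> 0 <= a ->
  (i <= m)%N -> alternates P (U 0%N) s (n + i.*2) a ->
  exists s', alternates P (U i) s' n a.
Proof.
move=> dn hU a0; elim: i n => [|i IH] n im; first by rewrite addn0; exists s.
rewrite doubleS -!addSnnS => /(IH _ (ltnW im))[s' h]; exists (- s').
apply: (next_alternates (alpha := alpha) a0); rewrite -[s']opprK.
have hW := radial_alternates_flux dn (hU i im) a0 h.
by apply: alternates_rolle hW => // r r0; have [] := hU i im r r0.
Qed.

(** * Bounds obtained by integrating between sign changes *)

(** An estimate that improves itself by a factor 2 forces f = 0. *)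
Lemma halving_zero (R : realType) (J : R -> Prop) (f w : R -> R) (M : R) :
  (forall M, 0 <= M -> (forall x, J x -> `|f x| <= M * w x) ->
     forall x, J x -> `|f x| <= M / 2 * w x) ->
  0 <= M -> (forall x, J x -> `|f x| <= M * w x) -> forall x, J x -> f x = 0.
Proof.
move=> half M0 hM x Jx; apply/eqP; rewrite -normr_le0 leNgt; apply/negP => fx0.
have H n : forall y, J y -> `|f y| <= M / 2 ^+ n * w y.
  elim: n => [|n IH]; first by rewrite expr0 divr1.
  have -> : M / 2 ^+ n.+1 = M / 2 ^+ n / 2 by rewrite exprS invfM mulrA mulrAC.
  by apply: half IH; rewrite divr_ge0// exprn_ge0.
have Mw : 0 <= M * w x by apply: le_trans (hM x Jx).
have [n] := exists_half_pow_lt Mw fx0.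
by rewrite mulrAC ltNge H.
Qed.

Lemma chain_bound_descent (R : realType) (m : nat) (J : R -> Prop)
    (U : nat -> R -> R) (w : nat -> R -> R) (theta K : R) :
  (0 < m)%N -> 0 <= theta <= 1 ->
  (forall i x, J x -> 0 <= w i x) ->
  (forall i K, (i < m)%N -> 0 <= K ->
     (forall x, J x -> `|U i.+1 x| <= K * w i.+1 x) ->
     forall x, J x -> `|U i x| <= theta * K * w i x) ->
  0 <= K -> (forall x, J x -> `|U m x| <= K * w m x) ->
  forall x, J x -> `|U 0%N x| <= theta * K * w 0%N x.
Proof.
move=> m0 /andP[t0 t1] w0 step K0 hm.
suff H : forall i, (i < m)%N -> forall x, J x ->
    `|U (m - i.+1)%N x| <= theta * K * w (m - i.+1)%N x.
  by have := H m.-1; rewrite prednK// subnn; apply.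
elim=> [|i IH] im; first by rewrite subn1; apply: step; rewrite ?prednK ?leqnn.
have e : (m - i.+2).+1 = (m - i.+1)%N by lia.
apply: step => //; first by lia.
move=> x Jx; rewrite e; apply: le_trans (IH (ltnW im) x Jx) _.
by rewrite ler_wpM2r ?w0// ler_piMl.
Qed.

(** Unique continuation in abstract form. The two integrations that lead from level
    i + 1 to level i cost a factor theta in the weighted norms given by w, and L
    measures U m against U 0. *)
Lemma chain_halving_zero (R : realType) (m : nat) (J : R -> Prop)
    (U : nat -> R -> R) (w : nat -> R -> R) (theta L M : R) :
  (0 < m)%N -> 0 <= theta <= 1 -> 0 <= L -> theta * L <= 2^-1 ->
  (forall i x, J x -> 0 <= w i x) ->
  (forall i K, (i < m)%N -> 0 <= K ->
     (forall x, J x -> `|U i.+1 x| <= K * w i.+1 x) ->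
     forall x, J x -> `|U i x| <= theta * K * w i x) ->
  (forall M x, 0 <= M -> J x -> `|U 0%N x| <= M * w 0%N x ->
     `|U m x| <= L * M * w m x) ->
  0 <= M -> (forall x, J x -> `|U 0%N x| <= M * w 0%N x) ->
  forall x, J x -> U 0%N x = 0.
Proof.
move=> m0 t01 L0 tL w0 step lip.
apply: halving_zero => K K0 hK x Jx.
have := chain_bound_descent m0 t01 w0 step (mulr_ge0 L0 K0)
  (fun y Jy => lip K y K0 Jy (hK y Jy)) Jx.
move=> /le_trans; apply; rewrite ler_wpM2r ?w0// mulrA.
by rewrite [K / 2]mulrC ler_wpM2r.
Qed.

(** A point where f > 0 bounds f from below and a point where f < 0 bounds it from
    above; no zero of f has to be produced. *)
Lemma sign_points_bound (R : realType) (f df : R -> R) (a b B z z' : R) :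
  0 <= a -> (forall x : R, 0 < x -> is_derive x (1 : R) f (df x)) -> 0 <= B ->
  (forall x, a < x -> x <= b -> `|df x| <= B) ->
  a < z -> z <= b -> 0 < f z -> a < z' -> z' <= b -> f z' < 0 ->
  forall r, a < r -> r <= b -> `|f r| <= B * (b - a).
Proof.
move=> a0 fd B0 hB az zb fz az' zb' fz' r ar rb.
have incr x y : a < x -> x <= b -> a < y -> y <= b -> `|f x - f y| <= B * (b - a).
  wlog xy : x y / y <= x => [H ax xb ay yb|].
    by have [xy|/ltW xy] := leP y x; [|rewrite distrC]; exact: H.
  move=> ax xb ay yb.
  have y0 : 0 < y := le_lt_trans a0 ay.
  have := increment_abs_le y0 xy fd (fun t _ => is_derive_lin B t) _.
  move=> /(_ _)/le_trans; apply.
    by move=> t yt tx; apply: hB; [exact: lt_trans yt | exact: le_trans (ltW tx) xb].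
  by rewrite -mulrBr ler_wpM2l// lerB// ltW.
have := incr r z ar rb az zb; have := incr r z' ar rb az' zb'.
rewrite !ler_norml => /andP[h1 h2] /andP[h3 h4]; apply/andP; split; lra.
Qed.

(** Two integrations over an interval of length b - a, first of the flux and then
    of u. *)
Lemma radial_bound_interior (R : realType) (alpha d T a b K : R) (u w z : R -> R) :
  0 <= alpha -> 0 < d -> d <= a -> b <= T -> radial_step alpha u w z ->
  (exists x y, [/\ a < x, x <= b, 0 < u x & [/\ a < y, y <= b & u y < 0]]) ->
  (exists x y, [/\ a < x, x <= b, 0 < w x & [/\ a < y, y <= b & w y < 0]]) ->
  0 <= K -> (forall r, a < r -> r <= b -> `|z r| <= K) ->
  forall r, a < r -> r <= b ->
    `|u r| <= d `^ (- alpha) * T `^ alpha * (b - a) ^+ 2 * K.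
Proof.
move=> al d0 da bT h [x [y [ax xb ux [ay yb uy]]]] [x' [y' [ax' xb' wx' [ay' yb' wy']]]] K0 hz.
have a0 : 0 < a := lt_le_trans d0 da.
have hw : forall r, a < r -> r <= b -> `|w r| <= T `^ alpha * K * (b - a).
  apply: (sign_points_bound (ltW a0) (fun r r0 => (h r r0).2) _ _ ax' xb' wx' ay' yb' wy').
    by rewrite mulr_ge0// powR_ge0.
  move=> r ar rb; rewrite normrN normrM ger0_norm ?powR_ge0//.
  apply: ler_pM; rewrite ?powR_ge0 ?hz//; apply: ge0_ler_powR => //.
  - by rewrite nnegrE ltW// (lt_trans a0).
  - by rewrite nnegrE ltW// (lt_le_trans (lt_le_trans (lt_trans a0 ar) rb)).
  - exact: le_trans bT.
have ab : a <= b := le_trans (ltW ax) xb.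
move=> r ar rb.
have -> : d `^ (- alpha) * T `^ alpha * (b - a) ^+ 2 * K =
  d `^ (- alpha) * (T `^ alpha * K * (b - a)) * (b - a) by ring.
apply: (sign_points_bound (ltW a0) (fun r r0 => (h r r0).1) _ _ ax xb ux ay yb uy) => //.
  by rewrite !mulr_ge0 ?powR_ge0// subr_ge0.
move=> t at0 tb; rewrite normrM ger0_norm ?powR_ge0//.
apply: ler_pM; rewrite ?powR_ge0 ?hw//.
have t0 := lt_trans a0 at0.
rewrite !powRN lef_pV2 ?posrE ?powR_gt0//.
by apply: ge0_ler_powR => //; rewrite ?nnegrE; lra.
Qed.

(** The flux is integrated from 0, where it vanishes, so sign changes are required
    of u only. *)
Lemma radial_bound_origin (R : realType) (alpha d K : R) (u w z : R -> R) :
  0 <= alpha -> 0 < d -> radial_step alpha u w z ->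
  w r @[r --> 0^'+] --> (0 : R) ->
  (exists x y, [/\ 0 < x, x <= d, 0 < u x & [/\ 0 < y, y <= d & u y < 0]]) ->
  0 <= K -> (forall r, 0 < r -> r <= d -> `|z r| <= K) ->
  forall r, 0 < r -> r <= d -> `|u r| <= d ^+ 2 * K.
Proof.
move=> al d0 h w0 [x [y [x0 xd ux [y0 yd uy]]]] K0 hz r r0 rd.
have a1 : 0 < alpha + 1 by lra.
pose G t := K / (alpha + 1) * t `^ (alpha + 1).
have dG (t : R) : 0 < t -> is_derive t (1 : R) G (K * t `^ alpha).
  move=> t0; apply: is_derive_eq (is_derive_cpow (K / (alpha + 1)) (alpha + 1) t0) _.
  by rewrite addrK; field; lra.
have hw t : 0 < t -> t <= d -> `|w t| <= t `^ alpha * (K * d).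
  move=> t0 td.
  have wG : `|w t| <= G t.
    rewrite leNgt; apply/negP => Gw.
    have e0 : 0 < `|w t| - G t by rewrite subr_gt0.
    have [p [p0 pt]] := cvg_right0_point w0 e0 t0; rewrite subr0 => wp.
    have : `|w t - w p| <= G t - G p.
      apply: (increment_abs_le p0 (ltW pt) (fun r r0 => (h r r0).2) dG).
      move=> s ps st; have s0 := lt_trans p0 ps.
      rewrite normrN normrM ger0_norm ?powR_ge0// mulrC ler_wpM2r ?powR_ge0//.
      by apply: hz => //; lra.
    have Gp : 0 <= G p by rewrite mulr_ge0 ?powR_ge0// divr_ge0// ltW.
    by have := lerB_dist (w t) (w p); lra.
  apply: (le_trans wG); rewrite /G powRD_pos// powRr1 ?(ltW t0)// mulrC -mulrA.
  have Ka : K / (alpha + 1) <= K by rewrite ler_pdivrMr// ler_peMr//; lra.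
  have Ka0 : 0 <= K / (alpha + 1) by rewrite divr_ge0// ltW.
  by rewrite ler_wpM2l ?powR_ge0// [t * _]mulrC ler_pM// ltW.
have -> : d ^+ 2 * K = K * d * (d - 0) by ring.
apply: (sign_points_bound (lexx 0) (fun r r0 => (h r r0).1) _ _ x0 xd ux y0 yd uy) => //.
  by rewrite mulr_ge0// ltW.
move=> t t0 td; rewrite normrM ger0_norm ?powR_ge0//.
by rewrite powRN mulrC ler_pdivrMr ?powR_gt0// [X in _ <= X]mulrC hw.
Qed.

(** Integration from infinity: sign changes at arbitrarily large points replace the
    limit 0 there. *)
Lemma far_sign_points_bound (R : realType) (f df : R -> R) (A kappa T : R) :
  (forall x : R, 0 < x -> is_derive x (1 : R) f (df x)) ->
  0 <= A -> 1 <= kappa -> 0 < T ->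
  (forall x, T <= x -> `|df x| <= A * x `^ (- kappa - 1)) ->
  (forall a, 0 < a -> exists z z', [/\ a < z, 0 < f z & a < z' /\ f z' < 0]) ->
  forall r, T <= r -> `|f r| <= A * r `^ (- kappa).
Proof.
move=> fd A0 k1 T0 hdf hz r Tr; have k0 : 0 < kappa by lra.
have r0 : 0 < r := lt_le_trans T0 Tr.
pose G t := - (A / kappa) * t `^ (- kappa).
have dG (t : R) : 0 < t -> is_derive t (1 : R) G (A * t `^ (- kappa - 1)).
  move=> t0; apply: is_derive_eq (is_derive_cpow (- (A / kappa)) (- kappa) t0) _.
  by field; lra.
have incr z : r < z -> `|f z - f r| <= A * r `^ (- kappa).
  move=> rz; apply: (le_trans (increment_abs_le r0 (ltW rz) fd dG _)).
    by move=> x rx _; apply: hdf; rewrite (le_trans Tr)// ltW.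
  rewrite /G !mulNr.
  have : 0 <= A / kappa * z `^ (- kappa) by rewrite mulr_ge0 ?powR_ge0// divr_ge0// ltW.
  have : A / kappa * r `^ (- kappa) <= A * r `^ (- kappa).
    by rewrite ler_wpM2r ?powR_ge0// ler_pdivrMr// ler_peMr.
  lra.
have [z [z' [rz fz [rz' fz']]]] := hz r r0.
have := incr z rz; have := incr z' rz'.
rewrite !ler_norml => /andP[h1 h2] /andP[h3 h4]; apply/andP; split; lra.
Qed.

(** Since alpha <= mu, both r^alpha z and the resulting bound on u' are integrable at
    infinity, and the exponents are large enough for both integrations to have
    constant at most 1. *)
Lemma radial_bound_pinfty (R : realType) (alpha mu A T : R) (u w z : R -> R) :
  1 <= alpha -> alpha <= mu -> 0 < T -> 0 <= A -> radial_step alpha u w z ->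
  (forall a, 0 < a -> exists x y, [/\ a < x, 0 < u x & a < y /\ u y < 0]) ->
  (forall a, 0 < a -> exists x y, [/\ a < x, 0 < w x & a < y /\ w y < 0]) ->
  (forall r, T <= r -> `|z r| <= A * r `^ (- (mu + 2))) ->
  forall r, T <= r -> `|u r| <= A * r `^ (- mu).
Proof.
move=> al mu0 T0 A0 h hu hw hz.
have hW : forall r, T <= r -> `|w r| <= A * r `^ (- (mu + 1 - alpha)).
  apply: (far_sign_points_bound (fun r r0 => (h r r0).2) _ _ _ _ hw) => //; first by lra.
  move=> r Tr; rewrite normrN normrM ger0_norm ?powR_ge0//.
  have r0 : 0 < r := lt_le_trans T0 Tr.
  have -> : - (mu + 1 - alpha) - 1 = alpha + - (mu + 2) by ring.
  by rewrite powRD_pos// mulrCA ler_wpM2l ?powR_ge0// hz.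
apply: (far_sign_points_bound (fun r r0 => (h r r0).1) _ _ _ _ hu) => //; first by lra.
move=> r Tr; rewrite normrM ger0_norm ?powR_ge0//.
have r0 : 0 < r := lt_le_trans T0 Tr.
have -> : - mu - 1 = - alpha + - (mu + 1 - alpha) by ring.
by rewrite powRD_pos// mulrCA ler_wpM2l ?powR_ge0// hW.
Qed.

(** * Finitely many sign alternations *)

(** Either k of the points lie below b, or n of them lie above. *)
Lemma alternates_split (R : realType) (f : R -> R) s k n (a b : R) :
  alternates (fun=> True) f s (k + n) a ->
  alternates (fun x => x <= b) f s k a \/
  exists s', alternates (fun=> True) f s' n b.
Proof.
elim: k s a => [|k IH] s a; first by left.
move=> [x [ax _ sx h]]; have [xb|bx] := leP x b.
  by have [h'|h'] := IH _ _ h; [left; exists x|right].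
right; exists s.
by apply: (@alternates_prefix _ _ _ _ n (k.+1 + n)); [lia|exists x].
Qed.

(** By [chain_alternates_loss], 2m + 2 alternations of U 0 leave at least two in every
    level below m and in every flux. *)
Lemma chain_sign_points (R : realType) (P : R -> Prop) (m : nat) (alpha : R)
    (U W : nat -> R -> R) s (a : R) i :
  (forall x y, y <= x -> P x -> P y) -> radial_chain m alpha U W -> 0 <= a ->
  (i < m)%N -> alternates P (U 0%N) s (m.*2 + 2) a ->
  (exists x y, [/\ a < x, P x, 0 < U i x & [/\ a < y, P y & U i y < 0]]) /\
  (exists x y, [/\ a < x, P x, 0 < W i x & [/\ a < y, P y & W i y < 0]]).
Proof.
move=> dn hU a0 im h; split.
  have h2 : alternates P (U 0%N) s (2 + i.*2) a by apply: alternates_prefix h; lia.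
  have [s' h'] := chain_alternates_loss dn hU a0 (ltnW im) h2.
  exact: alternates2 h'.
have h3 : alternates P (U 0%N) s (3 + i.*2) a by apply: alternates_prefix h; lia.
have [s' h'] := chain_alternates_loss dn hU a0 (ltnW im) h3.
exact: alternates2 (radial_alternates_flux dn (hU i im) a0 h').
Qed.

Lemma few_alternations_origin (R : realType) (m : nat) (alpha L B d : R)
    (U W : nat -> R -> R) s :
  (0 < m)%N -> 0 <= alpha -> radial_chain m alpha U W ->
  (forall i, (i < m)%N -> W i r @[r --> 0^'+] --> (0 : R)) ->
  0 <= L -> (forall r, 0 < r -> `|U m r| <= L * `|U 0%N r|) ->
  0 <= B -> (forall r, 0 < r -> `|U 0%N r| <= B) ->
  0 < d -> d ^+ 2 <= 1 -> d ^+ 2 * L <= 2^-1 ->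
  ~ alternates (fun x => x <= d) (U 0%N) s (m.*2 + 2) 0.
Proof.
move=> m0 al hU W0 L0 hL B0 hB d0 d1 dL hs.
have dn (x y : R) : y <= x -> x <= d -> y <= d by exact: le_trans.
suff U0 : forall x, 0 < x /\ x <= d -> U 0%N x = 0.
  move: hs; rewrite addn2 => -[x [x0 xd]]; rewrite U0//.
  by rewrite mulr0 ltxx.
apply: (@chain_halving_zero R m _ U (fun _ _ => 1) (d ^+ 2) L B) => //.
- by rewrite sqr_ge0.
- move=> i K im K0 hK x [x0 xd]; rewrite mulr1.
  have [hu _] := chain_sign_points dn hU (lexx 0) im hs.
  apply: (radial_bound_origin al d0 (hU i im) (W0 i im) hu K0) => // r r0 rd.
  by have := hK r (conj r0 rd); rewrite mulr1.
- move=> M x M0 [x0 xd]; rewrite !mulr1 => h.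
  by apply: le_trans (hL x x0) _; rewrite ler_wpM2l.
- by move=> x [x0 _]; rewrite mulr1 hB.
Qed.

Lemma few_alternations_interior (R : realType) (m : nat) (alpha L B d T a b : R)
    (U W : nat -> R -> R) s :
  (0 < m)%N -> 0 <= alpha -> radial_chain m alpha U W ->
  0 <= L -> (forall r, 0 < r -> `|U m r| <= L * `|U 0%N r|) ->
  0 <= B -> (forall r, 0 < r -> `|U 0%N r| <= B) ->
  0 < d -> d <= a -> b <= T ->
  d `^ (- alpha) * T `^ alpha * (b - a) ^+ 2 <= 1 ->
  d `^ (- alpha) * T `^ alpha * (b - a) ^+ 2 * L <= 2^-1 ->
  ~ alternates (fun x => x <= b) (U 0%N) s (m.*2 + 2) a.
Proof.
move=> m0 al hU L0 hL B0 hB d0 da bT d1 dL hs.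
have dn (x y : R) : y <= x -> x <= b -> y <= b by exact: le_trans.
have a0 : 0 < a := lt_le_trans d0 da.
suff U0 : forall x, a < x /\ x <= b -> U 0%N x = 0.
  move: hs; rewrite addn2 => -[x [ax xb]]; rewrite U0//.
  by rewrite mulr0 ltxx.
apply: (@chain_halving_zero R m _ U (fun _ _ => 1) _ L B _ _ L0 dL) => //.
- by rewrite d1 andbT mulr_ge0 ?sqr_ge0// mulr_ge0 ?powR_ge0.
- move=> i K im K0 hK x [ax xb]; rewrite mulr1.
  have [hu hw] := chain_sign_points dn hU (ltW a0) im hs.
  apply: (radial_bound_interior al d0 da bT (hU i im) hu hw K0) => // r ar rb.
  by have := hK r (conj ar rb); rewrite mulr1.
- move=> M x M0 [ax xb]; rewrite !mulr1 => h.
  by apply: le_trans (hL x (lt_trans a0 ax)) _; rewrite ler_wpM2l.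
- by move=> x [ax _]; rewrite mulr1 hB// (lt_trans a0).
Qed.

(** Otherwise all levels and fluxes change sign arbitrarily far out, and U 0 vanishes
    near infinity by integration from there. The first hypothesis on U m makes the
    starting bound of [chain_halving_zero] finite, the second one makes it improve. *)
Lemma few_alternations_pinfty (R : realType) (m : nat) (alpha mu A T : R)
    (U W : nat -> R -> R) :
  (0 < m)%N -> 1 <= alpha -> alpha <= mu -> 0 < T -> 0 <= A ->
  radial_chain m alpha U W ->
  (forall r, T <= r -> `|U m r| <= A * r `^ (- (mu + 2 * m%:R))) ->
  (forall r, T <= r -> `|U m r| <= 2^-1 * r `^ (- (2 * m%:R)) * `|U 0%N r|) ->
  exists2 b, 0 < b & exists n, forall s, ~ alternates (fun=> True) (U 0%N) s n b.
Proof.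
move=> m0 al amu T0 A0 hU hA hL; apply: contrapT => habs.
have many b n : 0 < b -> exists s, alternates (fun=> True) (U 0%N) s n b.
  move=> b0; apply: contrapT => hn; apply: habs; exists b => //; exists n => s hs.
  by apply: hn; exists s.
have pts b i : (i < m)%N -> 0 < b ->
    (exists x y, [/\ b < x, 0 < U i x & b < y /\ U i y < 0]) /\
    (exists x y, [/\ b < x, 0 < W i x & b < y /\ W i y < 0]).
  move=> im b0; have [s hs] := many b (m.*2 + 2)%N b0.
  have [[x [y [bx _ ux [by_ _ uy]]]] [x' [y' [bx' _ wx [by' _ wy]]]]] :=
    chain_sign_points (fun _ _ _ _ => I) hU (ltW b0) im hs.
  by split; [exists x, y|exists x', y'].
pose w (i : nat) (r : R) := r `^ (- (mu + 2 * i%:R)).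
have w0 i x : T <= x -> 0 <= w i x by move=> _; exact: powR_ge0.
have step i K : (i < m)%N -> 0 <= K ->
    (forall x, T <= x -> `|U i.+1 x| <= K * w i.+1 x) ->
    forall x, T <= x -> `|U i x| <= 1 * K * w i x.
  move=> im K0 hK x Tx; rewrite mul1r.
  apply: (radial_bound_pinfty al _ T0 K0 (hU i im)) Tx.
  - by have := ler0n R i; lra.
  - by move=> b b0; have [] := pts b i im b0.
  - by move=> b b0; have [] := pts b i im b0.
  - move=> r Tr; have := hK r Tr; rewrite /w.
    by have -> : mu + 2 * i%:R + 2 = mu + 2 * i.+1%:R by rewrite -natr1; ring.
have t01 : 0 <= (1 : R) <= 1 by rewrite ler01 lexx.
have U0A := chain_bound_descent m0 t01 w0 step A0 hA.
have : forall x, T <= x -> U 0%N x = 0.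
  apply: (@chain_halving_zero R m _ U w 1 2^-1 _ m0 t01 _ _ w0 step _ _ U0A).
  - by rewrite invr_ge0.
  - by rewrite mul1r lexx.
  - move=> M x M0 Tx hM; apply: (le_trans (hL x Tx)).
    have x0 : 0 < x := lt_le_trans T0 Tx.
    have -> : 2^-1 * M * w m x = 2^-1 * x `^ (- (2 * m%:R)) * (M * w 0%N x).
      rewrite /w mulr0 addr0 -[- (mu + _)]/(- (mu + 2 * m%:R)) opprD powRD_pos//.
      ring.
    by rewrite ler_wpM2l// mulr_ge0 ?powR_ge0// invr_ge0.
  - by rewrite mul1r.
have [s [x [Tx _ sx _]]] := many T 1%N T0.
by move=> /(_ x (ltW Tx)) ux; move: sx; rewrite ux mulr0 ltxx.
Qed.

(** A neighbourhood of infinity, a neighbourhood of 0 and finitely many short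
    intervals in between each carry a bounded number of alternations. *)
Lemma finite_alternations (R : realType) (m : nat) (alpha L B mu A T : R)
    (U W : nat -> R -> R) :
  (0 < m)%N -> 1 <= alpha -> radial_chain m alpha U W ->
  (forall i, (i < m)%N -> W i r @[r --> 0^'+] --> (0 : R)) ->
  0 <= L -> (forall r, 0 < r -> `|U m r| <= L * `|U 0%N r|) ->
  0 <= B -> (forall r, 0 < r -> `|U 0%N r| <= B) ->
  alpha <= mu -> 0 < T -> 0 <= A ->
  (forall r, T <= r -> `|U m r| <= A * r `^ (- (mu + 2 * m%:R))) ->
  (forall r, T <= r -> `|U m r| <= 2^-1 * r `^ (- (2 * m%:R)) * `|U 0%N r|) ->
  exists n, forall s, ~ alternates (fun=> True) (U 0%N) s n 0.
Proof.
move=> m0 al hU W0 L0 hL B0 hB amu T0 A0 hA hT.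
have al0 : 0 <= alpha by lra.
pose fin a := exists n, forall s, ~ alternates (fun=> True) (U 0%N) s n a.
have finS a b : (forall s, ~ alternates (fun x => x <= b) (U 0%N) s (m.*2 + 2) a) ->
    fin b -> fin a.
  move=> hab [n hn]; exists (m.*2 + 2 + n)%N => s /(@alternates_split _ _ _ _ _ _ b).
  by case=> [|[s']]; [exact: hab | exact: hn].
have finle a b : a <= b -> fin a -> fin b.
  move=> ab [n hn]; exists n => s /(alternates_start ab); exact: hn.
(* the estimates on an interval of length d come with a factor of the form c d^2 *)
have small (c : R) : 0 <= c -> exists2 d, 0 < d & c * d ^+ 2 <= 1 /\ c * d ^+ 2 * L <= 2^-1.
  move=> c0; pose k := 1 + 2 * c * (1 + L).
  have cL : 0 <= c * L by rewrite mulr_ge0.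
  have k1 : 1 <= k by rewrite /k; lra.
  have kL : c <= k /\ c * L * 2 <= k by rewrite /k; split; lra.
  exists k^-1; first by rewrite invr_gt0; lra.
  have ki : c * k^-1 ^+ 2 <= c / k.
    rewrite expr2 mulrA ler_piMr//; first by rewrite divr_ge0//; lra.
    by rewrite invf_le1//; lra.
  have k0 : 0 < k by lra.
  split; first by apply: (le_trans ki); rewrite ler_pdivrMr// mul1r; case: kL.
  apply: (@le_trans _ _ (c / k * L)); first by rewrite ler_wpM2r.
  by rewrite mulrAC ler_pdivrMr//; case: kL => _; lra.
have [b0 b00 finb0] := few_alternations_pinfty m0 al amu T0 A0 hU hA hT.
have [d d0 [d1 dL]] := small 1 ler01.
move: d1 dL; rewrite mul1r => d1 dL.
apply: (finS _ d) => [s|]; first exact: few_alternations_origin hU W0 L0 hL B0 hB d0 d1 dL.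
pose b := Num.max b0 d.
have finb : fin b by apply: (finle b0) => //; rewrite le_max lexx.
have db : d <= b by rewrite le_max lexx orbT.
have [l l0 [l1 lL]] := small (d `^ (- alpha) * b `^ alpha)
  (mulr_ge0 (powR_ge0 _ _) (powR_ge0 _ _)).
(* finiteness moves to the left from b to d in steps of length l *)
have H j : fin (Num.max d (b - j%:R * l)).
  elim: j => [|j IH]; first by rewrite mul0r subr0 max_r.
  pose y := Num.max d (b - j%:R * l); pose x := Num.max d (b - j.+1%:R * l).
  apply: (finS _ y) IH => s.
  have dx : d <= x by rewrite le_max lexx.
  have jl : j.+1%:R * l = j%:R * l + l by rewrite -natr1; ring.
  have xy : 0 <= y - x <= l.
    have jl0 : 0 <= j%:R * l by rewrite mulr_ge0// ltW.
    by rewrite /x /y jl; case: (leP d (b - j%:R * l)); case: (leP d (b - (j%:R * l + l))); lra.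
  have yx2 : (y - x) ^+ 2 <= l ^+ 2 by rewrite ler_sqr ?nnegrE; lra.
  have yb : y <= b by rewrite ge_max db lerBlDr lerDl mulr_ge0// ltW.
  have c0 : 0 <= d `^ (- alpha) * b `^ alpha by rewrite mulr_ge0 ?powR_ge0.
  apply: (few_alternations_interior m0 al0 hU L0 hL B0 hB d0 dx yb).
  - by apply: le_trans l1; rewrite ler_wpM2l.
  - by apply: le_trans lL; rewrite ler_wpM2r// ler_wpM2l.
have bl : 0 <= b / l by rewrite divr_ge0//; lra.
have := H (Num.bound (b / l)); have := archi_boundP bl.
rewrite ltr_pdivrMr// => hj; rewrite max_l//; lra.
Qed.

(** * The bubble and its iterated Laplacians *)

Lemma cvg_right0_pow (R : realType) (f : R -> R) (a C d : R) : 0 < a -> 0 < d ->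
  (forall r, 0 < r -> r < d -> `|f r| <= C * r `^ a) -> f r @[r --> 0^'+] --> (0 : R).
Proof.
move=> a0 d0 hf; apply/cvg_right0P => e e0.
have k0 : 0 < `|C| + 1 by have := normr_ge0 C; lra.
have [|d' d'0 hd] := (cvg_right0P _ _).1 (powR_cvg0 a0) (e / (`|C| + 1)).
  by rewrite divr_gt0.
exists (Num.min d d'); first by rewrite lt_min d0.
move=> x x0; rewrite lt_min => /andP[xd xd']; rewrite subr0.
have := hd x x0 xd'; rewrite subr0 ger0_norm ?powR_ge0// ltr_pdivlMr// => h.
apply: le_lt_trans (hf x x0 xd) _; apply: le_lt_trans h.
rewrite mulrC ler_wpM2l ?powR_ge0//; have := ler_norm C; lra.
Qed.

Lemma cvg_pinfty_pow (R : realType) (f : R -> R) (a C T : R) : 0 < a ->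
  (forall r, T <= r -> `|f r| <= C * r `^ (- a)) -> f r @[r --> +oo] --> (0 : R).
Proof.
move=> a0 hf; apply/cvg_pinftyP => e e0.
have k0 : 0 < `|C| + 1 by have := normr_ge0 C; lra.
pose k := (`|C| + 1) / e; have kp : 0 < k by rewrite divr_gt0.
exists (Num.max T (k `^ a^-1)); first by rewrite lt_max powR_gt0 ?orbT.
move=> x; rewrite ge_max => /andP[Tx kx].
have x0 : 0 < x by apply: lt_le_trans kx; exact: powR_gt0.
apply: le_lt_trans (hf x Tx) _; rewrite powRN ltr_pdivrMr ?powR_gt0//.
have : k <= x `^ a.
  have -> : k = (k `^ a^-1) `^ a by rewrite -powRrM mulVf ?gt_eqF// powRr1// ltW.
  by apply: ge0_ler_powR; rewrite ?nnegrE ?powR_ge0// ltW.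
rewrite ler_pdivrMr// mulrC; have := ler_norm C; lra.
Qed.

Lemma radial_step_sum (R : realType) (alpha : R) n (u w z : nat -> R -> R) (c : nat -> R) :
  (forall j, (j < n)%N -> radial_step alpha (u j) (w j) (z j)) ->
  radial_step alpha (fun r => \sum_(j < n) c j * u j r)
    (fun r => \sum_(j < n) c j * w j r) (fun r => \sum_(j < n) c j * z j r).
Proof.
elim: n => [|n IH] h.
  have E (f : nat -> R -> R) : (fun r => \sum_(j < 0) c j * f j r) = fun=> 0.
    by apply/funext => r; rewrite big_ord0.
  rewrite !E => r r0; rewrite !mulr0 oppr0.
  by split; exact: is_derive_cst.
have E (f : nat -> R -> R) : (fun r => \sum_(j < n.+1) c j * f j r) =
    fun r => 1 * (\sum_(j < n) c j * f j r) + c n * f n r.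
  by apply/funext => r; rewrite big_ord_recr mul1r.
rewrite !E; apply: radial_step_comb; last exact: h.
by apply: IH => j jn; apply: h; exact: ltnW.
Qed.

Lemma quad_gt0 (R : realType) (eps r : R) : 0 < eps -> 0 < eps ^+ 2 + r ^+ 2.
Proof. by move=> e0; rewrite ltr_pwDl ?exprn_gt0// sqr_ge0. Qed.

Lemma is_derive_quad_pow (R : realType) (eps s r : R) : 0 < eps ->
  is_derive r (1 : R) (fun x => (eps ^+ 2 + x ^+ 2) `^ (- s))
    (- (2 * s) * r * (eps ^+ 2 + r ^+ 2) `^ (- (s + 1))).
Proof.
move=> e0; have q0 := quad_gt0 r e0.
have dq : is_derive r (1 : R) (fun x : R => eps ^+ 2 + x ^+ 2) (2 * r).
  apply: is_derive_eq
    (is_deriveD (is_derive_cst (eps ^+ 2) r 1) (is_deriveX 2 (is_derive_id r (1 : R)))) _.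
  by rewrite /GRing.scale /=; ring.
have h := @is_derive1_comp R (fun y => y `^ (- s)) (fun x : R => eps ^+ 2 + x ^+ 2) r _ _
  (is_derive1_powR (- s) q0) dq.
apply: is_derive_eq h _.
by rewrite opprD; ring.
Qed.

(** The factor r^2 that appears on differentiating q^(-s) twice is q - eps^2. *)
Lemma radial_step_quad_pow (R : realType) (alpha eps s : R) : 0 < eps ->
  let q (r : R) := eps ^+ 2 + r ^+ 2 in
  radial_step alpha (fun r => q r `^ (- s))
    (fun r => - (2 * s) * (r `^ (alpha + 1) * q r `^ (- (s + 1))))
    (fun r => 2 * s * (alpha - 1 - 2 * s) * q r `^ (- (s + 1)) +
              4 * s * (s + 1) * eps ^+ 2 * q r `^ (- (s + 2))).
Proof.
move=> e0 q r r0; have q0 : 0 < q r := quad_gt0 r e0; split.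
  apply: is_derive_eq (is_derive_quad_pow s r e0) _.
  rewrite -/(q r) powRD_pos// powRr1 ?ltW//.
  transitivity (r `^ (- alpha) * r `^ alpha * (- (2 * s) * r * q r `^ (- (s + 1)))).
    by rewrite powRVK// mul1r.
  by ring.
apply: is_derive_eq (is_deriveZ (- (2 * s))
  (is_deriveM (is_derive1_powR (alpha + 1) r0) (is_derive_quad_pow (s + 1) r e0))) _.
rewrite -/(q r) /GRing.scale /= addrK powRD_pos// powRr1 ?ltW//.
have -> : s + 1 + 1 = s + 2 by ring.
have -> : q r `^ (- (s + 1)) = (eps ^+ 2 + r ^+ 2) * q r `^ (- (s + 2)).
  have -> : - (s + 1) = 1 + - (s + 2) by ring.
  by rewrite powRD_pos// powRr1 ?ltW.
by ring.
Qed.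

(** Up to powers of 2 and eps and a rising factorial, the coefficient of
    q^(-(g + i + j)) in (-Delta_alpha)^i q^(-g), where q = eps^2 + r^2. The closed form
    solves the recursion [bubble_coefS0], [bubble_coefSS] that comes from
    [radial_step_quad_pow] when alpha - 1 - 2 g = 2 (m - 1). For i = m the falling
    factorial leaves only j = m. *)
Definition bubble_coef (R : realType) (m i j : nat) : R :=
  ('C(i, j) * (m.-1 - j) ^_ (i - j))%:R.

Lemma natr_ffactS (R : realType) (n k : nat) :
  ((n ^_ k.+1)%:R : R) = (n ^_ k)%:R * (n%:R - k%:R).
Proof.
rewrite ffactnSr natrM; have [kn|nk] := leqP k n; first by rewrite natrB.
by rewrite ffact_small// !mul0r.
Qed.

Lemma bubble_coefS0 (R : realType) (m i : nat) : (i < m)%N ->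
  bubble_coef R m i.+1 0 = (m%:R - 1 - i%:R) * bubble_coef R m i 0.
Proof.
case: m => // m im.
rewrite /bubble_coef !bin0 !mul1n !subn0 natr_ffactS /= -natr1; ring.
Qed.

Lemma bubble_coefSS (R : realType) (m i j : nat) : (i < m)%N ->
  bubble_coef R m i.+1 j.+1 =
  (m%:R - 1 - i%:R - j.+1%:R) * bubble_coef R m i j.+1 + bubble_coef R m i j.
Proof.
move=> im; rewrite /bubble_coef; have [ij|ji|->] := ltngtP i j.
- by rewrite !bin_small ?mul0n ?mulr0 ?addr0// ltnW.
- have [n en] : exists n, m = (n + j.+2)%N.
    by exists (m - j.+2)%N; rewrite subnK// (leq_trans _ im).
  have [k ek] : exists k, i = (k + j.+1)%N by exists (i - j.+1)%N; rewrite subnK.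
  have -> : (m.-1 - j.+1 = n)%N by lia.
  have -> : (m.-1 - j = n.+1)%N by lia.
  have -> : (i.+1 - j.+1 = k.+1)%N by lia.
  have -> : (i - j.+1 = k)%N by lia.
  have -> : (i - j = k.+1)%N by lia.
  have hb := mul_bin_left i j.
  have e : (i - j = k.+1)%N by lia.
  rewrite e in hb.
  have {}hb : (j.+1%:R : R) * ('C(i, j.+1))%:R = k.+1%:R * ('C(i, j))%:R.
    by rewrite -!natrM hb.
  have hA := natr_ffactS R n k.
  rewrite binS (_ : n.+1 ^_ k.+1 = (n.+1 * n ^_ k)%N)//.
  move: ('C(i, j.+1)) ('C(i, j)) (n ^_ k.+1) (n ^_ k) hA hb => x y A B hA hb.
  rewrite !natrM natrD hA en ek !natrD -!natr1.
  have {}hb : (j%:R + 1 : R) * x%:R = (k%:R + 1) * y%:R by move: hb; rewrite -!natr1.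
  have -> : (n%:R + (j%:R + 1 + 1) - 1 - (k%:R + (j%:R + 1)) - (j%:R + 1)) * (x%:R * B%:R)
    = (n%:R - k%:R) * x%:R * B%:R - ((j%:R + 1) * x%:R) * B%:R :> R by ring.
  by rewrite hb; ring.
- by rewrite (@bin_small j j.+1)// mul0n mulr0 add0r !binn !mul1n !subnn.
Qed.

Lemma bubble_coef_last (R : realType) (m j : nat) : (0 < m)%N -> (j <= m)%N ->
  bubble_coef R m m j = (j == m)%:R.
Proof.
move=> m0; rewrite leq_eqVlt => /predU1P[->|jm].
  by rewrite /bubble_coef binn mul1n subnn eqxx.
by rewrite /bubble_coef ltn_eqF// ffact_small ?muln0//; lia.
Qed.

Lemma sum_ord_shift (R : realType) (n : nat) (a b Q : nat -> R) :
  b n = 0 ->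
  \sum_(j < n.+1) (a j * Q j + b j * Q j.+1) =
  \sum_(j < n.+1) (a j + (if (j : nat) is k.+1 then b k else 0)) * Q j.
Proof.
move=> bn; under [RHS]eq_bigr do rewrite mulrDl.
rewrite !big_split /=; congr (_ + _).
by rewrite big_ord_recr /= bn mul0r addr0 big_ord_recl mul0r add0r.
Qed.

Definition rising (R : realType) (g : R) (n : nat) : R := \prod_(l < n) (g + l%:R).

Lemma risingS (R : realType) (g : R) n : rising g n.+1 = rising g n * (g + n%:R).
Proof. by rewrite /rising big_ord_recr. Qed.

(** (-Delta_alpha)^i (eps^2 + r^2)^(-g) in powers of eps^2 + r^2, for i <= m. *)
Definition bubble_level (R : realType) (m : nat) (g eps : R) (i : nat) (r : R) : R :=
  \sum_(j < m.+1) (4 ^+ i * eps ^+ (2 * j) * rising g (i + j) * bubble_coef R m i j) *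
    (eps ^+ 2 + r ^+ 2) `^ (- (g + (i + j)%:R)).

Definition bubble_flux (R : realType) (m : nat) (alpha g eps : R) (i : nat) (r : R) : R :=
  \sum_(j < m.+1) (4 ^+ i * eps ^+ (2 * j) * rising g (i + j) * bubble_coef R m i j) *
    (- (2 * (g + (i + j)%:R)) *
     (r `^ (alpha + 1) * (eps ^+ 2 + r ^+ 2) `^ (- (g + (i + j)%:R + 1)))).

Lemma bubble_chain (R : realType) (m : nat) (alpha g eps : R) :
  0 < eps -> g = (alpha - 2 * m%:R + 1) / 2 ->
  radial_chain m alpha (bubble_level m g eps) (bubble_flux m alpha g eps).
Proof.
move=> e0 eg i im.
pose c j : R := 4 ^+ i * eps ^+ (2 * j) * rising g (i + j) * bubble_coef R m i j.
have := @radial_step_sum R alpha m.+1 _ _ _ c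
  (fun j _ => radial_step_quad_pow alpha (g + (i + j)%:R) e0).
rewrite -/(bubble_level m g eps i) -/(bubble_flux m alpha g eps i).
suff -> : bubble_level m g eps i.+1 = fun r => \sum_(j < m.+1) c j *
  (2 * (g + (i + j)%:R) * (alpha - 1 - 2 * (g + (i + j)%:R)) *
     (eps ^+ 2 + r ^+ 2) `^ (- (g + (i + j)%:R + 1)) +
   4 * (g + (i + j)%:R) * (g + (i + j)%:R + 1) * eps ^+ 2 *
     (eps ^+ 2 + r ^+ 2) `^ (- (g + (i + j)%:R + 2))) by [].
apply/funext => r; rewrite /bubble_level.
pose Q (j : nat) := (eps ^+ 2 + r ^+ 2) `^ (- (g + (i.+1 + j)%:R)).
pose a j := c j * (2 * (g + (i + j)%:R) * (alpha - 1 - 2 * (g + (i + j)%:R))).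
pose b j := c j * (4 * (g + (i + j)%:R) * (g + (i + j)%:R + 1) * eps ^+ 2).
transitivity (\sum_(j < m.+1) (a j * Q j + b j * Q j.+1)); last first.
  apply: eq_bigr => j _; rewrite /a /b /Q.
  have -> : g + (i + j)%:R + 1 = g + (i.+1 + j)%:R :> R by rewrite addSn -natr1; ring.
  have -> : g + (i + j)%:R + 2 = g + (i.+1 + j.+1)%:R :> R.
    by rewrite addSnnS !addnS -!natr1; ring.
  by ring.
rewrite sum_ord_shift; last first.
  by rewrite /b /c /bubble_coef bin_small// mul0n mulr0 mul0r.
apply: eq_bigr => -[j jm] _ /=; congr (_ * _).
have ea : alpha = 2 * g + 2 * m%:R - 1 by rewrite eg; field.
case: j jm => [|j] jm; rewrite /a /b /c ?(bubble_coefS0 R im) ?(bubble_coefSS R j im).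
  by rewrite !addn0 risingS exprS ea; ring.
rewrite addSn risingS !addnS risingS ea exprS mulnS exprD -!natr1 !natrD; ring.
Qed.

Lemma bubble_level0 (R : realType) (m : nat) (g eps r : R) :
  bubble_level m g eps 0 r = (eps ^+ 2 + r ^+ 2) `^ (- g).
Proof.
rewrite /bubble_level big_ord_recl big1 => [|j _].
  by rewrite /bubble_coef bin0 /rising big_ord0 /= addr0 !expr0 !mul1r addr0.
by rewrite /bubble_coef bin_small// mul0n mulr0 mul0r.
Qed.

Lemma bubble_level_last (R : realType) (m : nat) (g eps r : R) : (0 < m)%N ->
  bubble_level m g eps m r =
  4 ^+ m * eps ^+ (2 * m) * rising g (2 * m) * (eps ^+ 2 + r ^+ 2) `^ (- (g + 2 * m%:R)).
Proof.
move=> m0; rewrite /bubble_level big_ord_recr big1 => [|j _] /=.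
  by rewrite bubble_coef_last// eqxx mulr1 add0r addnn -mul2n natrM.
by rewrite bubble_coef_last ?(ltnW (ltn_ord j))// ltn_eqF// mulr0 mul0r.
Qed.

Lemma bubble_flux_cvg0 (R : realType) (m : nat) (alpha g eps : R) i :
  0 < eps -> 0 < g -> 0 < alpha + 1 ->
  bubble_flux m alpha g eps i r @[r --> 0^'+] --> (0 : R).
Proof.
move=> e0 g0 a0.
pose c (j : nat) : R := 4 ^+ i * eps ^+ (2 * j) * rising g (i + j) * bubble_coef R m i j.
pose k (j : nat) := `|c j * - (2 * (g + (i + j)%:R))| * (eps ^+ 2) `^ (- (g + (i + j)%:R + 1)).
apply: (@cvg_right0_pow R _ (alpha + 1) (\sum_(j < m.+1) k j) 1 a0 ltr01) => r r0 _.
rewrite mulr_suml; apply: le_trans (ler_norm_sum _ _ _) _; apply: ler_sum => j _.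
rewrite -/(c j) mulrA normrM /k -!mulrA ler_wpM2l// mulrC normrM.
rewrite !ger0_norm ?powR_ge0// ler_wpM2r ?powR_ge0//.
have s0 : 0 <= g + (i + j)%:R + 1 by have := ler0n R (i + j); lra.
rewrite !powRN lef_pV2 ?posrE ?powR_gt0 ?quad_gt0 ?exprn_gt0//.
apply: ge0_ler_powR => //; first by rewrite nnegrE sqr_ge0.
  by rewrite nnegrE ltW// quad_gt0.
by rewrite lerDl sqr_ge0.
Qed.

Lemma bubble_level_decay (R : realType) (m : nat) (g eps : R) i :
  0 < eps -> 0 < g -> exists2 C : R, 0 <= C &
  forall r, 1 <= r -> `|bubble_level m g eps i r| <= C * r `^ (- (2 * g)).
Proof.
move=> e0 g0.
pose c (j : nat) : R := 4 ^+ i * eps ^+ (2 * j) * rising g (i + j) * bubble_coef R m i j.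
exists (\sum_(j < m.+1) `|c j|); first by apply: sumr_ge0.
move=> r r1; have r0 : 0 < r by lra.
rewrite mulr_suml; apply: le_trans (ler_norm_sum _ _ _) _; apply: ler_sum => j _.
rewrite -/(c j) normrM ler_wpM2l// ger0_norm ?powR_ge0//.
have q1 : 1 <= eps ^+ 2 + r ^+ 2.
  by rewrite (le_trans (exprn_ege1 2 r1))// lerDr sqr_ge0.
apply: (@le_trans _ _ ((eps ^+ 2 + r ^+ 2) `^ (- g))).
  by apply: ler_powR => //; rewrite lerN2 lerDl ler0n.
rewrite !powRN lef_pV2 ?posrE ?powR_gt0 ?quad_gt0//.
rewrite powRrM powR_mulrn ?(ltW r0)//.
apply: ge0_ler_powR; rewrite ?(ltW g0) ?nnegrE ?sqr_ge0//; last by rewrite lerDr sqr_ge0.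
by rewrite ltW// quad_gt0.
Qed.

(** * Behaviour of the iterated Laplacians at the origin *)

(** The derivatives f^(j), j < n, exist and are O(r^(-k-j)) at 0. Because of this
    scaling, f |-> f / r raises k by one exactly as differentiation does, so
    Delta_alpha raises k by two. *)
Fixpoint tame_at0 (R : realType) (n k : nat) (f : R -> R) : Prop :=
  if n is n'.+1 then
    [/\ forall r : R, 0 < r -> derivable f r 1,
        exists C d : R, 0 < d /\ forall r, 0 < r -> r < d -> `|f r| * r ^+ k <= C
      & tame_at0 n' k.+1 (derive1 f)]
  else True.

Lemma eq_derive1_pos (R : realType) (f g : R -> R) (r : R) :
  (forall r, 0 < r -> f r = g r) -> 0 < r ->
  (derivable f r 1 -> derivable g r 1) /\ derive1 f r = derive1 g r.
Proof.
move=> fg r0; have nfg : \near r, f r = g r.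
  by near=> x; apply: fg; near: x; exact: lt_nbhsr.
split; first exact: near_eq_derivable.
by rewrite !derive1E; exact: near_eq_derive.
Unshelve. all: by end_near. Qed.

Lemma is_derive_derive1 (R : realType) (f : R -> R) (r : R) :
  derivable f r 1 -> is_derive r (1 : R) f (derive1 f r).
Proof. by move=> df; rewrite derive1E; exact: derivableP. Qed.

Lemma derive1_val (R : realType) (f : R -> R) (r d : R) :
  is_derive r (1 : R) f d -> derive1 f r = d.
Proof. by case=> _ <-; rewrite derive1E. Qed.

Lemma tame_ext (R : realType) n k (f g : R -> R) :
  (forall r, 0 < r -> f r = g r) -> tame_at0 n k f -> tame_at0 n k g.
Proof.
elim: n k f g => [//|n IH] k f g fg /= [df [C [d [d0 hC]]] h]; split.
- by move=> r r0; apply: (eq_derive1_pos fg r0).1; exact: df.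
- by exists C, d; split => // r r0 rd; rewrite -fg// hC.
- by apply: IH h => r r0; exact: (eq_derive1_pos fg r0).2.
Qed.

Lemma tame_lower (R : realType) n n' k (f : R -> R) :
  (n' <= n)%N -> tame_at0 n k f -> tame_at0 n' k f.
Proof.
elim: n' n k f => [//|n' IH] [//|n] k f nn' /= [df hC h]; split => //.
exact: IH h.
Qed.

Lemma tame_comb (R : realType) n k (a b : R) (f g : R -> R) :
  tame_at0 n k f -> tame_at0 n k g -> tame_at0 n k (fun r => a * f r + b * g r).
Proof.
elim: n k f g => [//|n IH] k f g /= [df [C [d [d0 hC]]] h] [dg [C' [d' [d'0 hC']]] h'].
have D (r : R) : 0 < r -> is_derive r (1 : R) (fun r => a * f r + b * g r)
    (a * derive1 f r + b * derive1 g r).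
  move=> r0.
  exact: (is_deriveD (is_deriveZ a (is_derive_derive1 (df r r0)))
                     (is_deriveZ b (is_derive_derive1 (dg r r0)))).
split.
- by move=> r /D[].
- exists (`|a| * C + `|b| * C'), (Num.min d d'); split; first by rewrite lt_min d0.
  move=> r r0; rewrite lt_min => /andP[rd rd'].
  have H1 := ler_wpM2l (normr_ge0 a) (hC r r0 rd).
  have H2 := ler_wpM2l (normr_ge0 b) (hC' r r0 rd').
  have : `|a * f r + b * g r| * r ^+ k <= (`|a| * `|f r| + `|b| * `|g r|) * r ^+ k.
    by rewrite ler_wpM2r ?exprn_ge0 ?(ltW r0)// -!normrM ler_normD.
  lra.
- by apply: tame_ext (IH _ _ _ h h') => r /D/derive1_val ->.
Qed.

Lemma tame_divX (R : realType) n k (f : R -> R) :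
  tame_at0 n k f -> tame_at0 n k.+1 (fun r => r^-1 * f r).
Proof.
elim: n k f => [//|n IH] k f hf; have [df [C [d [d0 hC]]] h] := hf.
have D (r : R) : 0 < r -> is_derive r (1 : R) (fun r => r^-1 * f r)
    (1 * (r^-1 * derive1 f r) + - 1 * (r^-1 * (r^-1 * f r))).
  move=> r0; have rn0 : r != 0 by rewrite gt_eqF.
  apply: is_derive_eq
    (is_deriveM (is_deriveV rn0 (is_derive_id r (1 : R))) (is_derive_derive1 (df r r0))) _.
  by rewrite /GRing.scale /=; field.
split.
- by move=> r /D[].
- exists C, d; split => // r r0 rd.
  have -> : `|r^-1 * f r| * r ^+ k.+1 = `|f r| * r ^+ k.
    rewrite normrM (gtr0_norm (_ : 0 < r^-1)) ?invr_gt0// exprS.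
    have rn0 : r != 0 by rewrite gt_eqF.
    by field.
  exact: hC.
- apply: (@tame_ext R n k.+2 (fun r => 1 * (r^-1 * derive1 f r) + - 1 * (r^-1 * (r^-1 * f r)))).
    by move=> r /D/derive1_val ->.
  apply: tame_comb; first exact: IH.
  by apply: (IH); apply: (IH); apply: tame_lower hf.
Qed.

Lemma tame_Delta (R : realType) n k (alpha : R) (f : R -> R) :
  tame_at0 n.+2 k f -> tame_at0 n k.+2 (fun r => - Delta alpha f r).
Proof.
move=> [df _ [ddf hC h]].
apply: (@tame_ext R n k.+2 (fun r => - 1 * derive1 (derive1 f) r +
    - alpha * (r^-1 * derive1 f r))).
  by move=> r r0; rewrite (DeltaE alpha r0 (ddf r r0)) derive1nS derive1n1; ring.
apply: tame_comb => //; apply: tame_divX.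
by apply: (@tame_lower R n.+1) => //.
Qed.

Lemma tame_of_nonsingular (R : realType) (n : nat) (v : R -> R) :
  Ck n v -> nonsingular0 n.-1 v -> tame_at0 n 0 v.
Proof.
move=> [dv _] hns; rewrite -[v]/(v^`(0)).
suff H : forall k j, (k + j <= n)%N -> tame_at0 k j (v^`(j)).
  by apply: H; rewrite addn0.
elim=> [//|k IH] j kj; split.
- by move=> r r0; apply: dv => //; lia.
- have jn : (j <= n.-1)%N by lia.
  have [d d0 hd] := (cvg_right0P _ _).1 (hns j jn) 1 ltr01.
  set l := lim _ in hd.
  exists (`|l| + 1), (Num.min d 1); split; first by rewrite lt_min d0 ltr01.
  move=> r r0; rewrite lt_min => /andP[rd r1].
  have := hd r r0 rd => hl.
  have : `|derive1n j v r| * r ^+ j <= `|derive1n j v r|.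
    by rewrite ler_piMr// exprn_ile1// ltW.
  have := ler_normD (derive1n j v r - l) l; rewrite subrK; lra.
- by rewrite -derive1nS; apply: IH; rewrite addnS.
Qed.

Definition polyflux (R : realType) (alpha : R) (v : R -> R) (i : nat) (r : R) : R :=
  r `^ alpha * derive1 (polyDelta i alpha v) r.

Lemma polyDelta_tame (R : realType) (m : nat) (alpha : R) (v : R -> R) :
  tame_at0 (2 * m) 0 v ->
  forall i, (i <= m)%N -> tame_at0 (2 * (m - i)) (2 * i) (polyDelta i alpha v).
Proof.
move=> hv; elim=> [|i IH] im; first by rewrite subn0.
rewrite (_ : 2 * i.+1 = (2 * i).+2)%N; last by lia.
apply: tame_Delta.
by have := IH (ltnW im); rewrite (_ : 2 * (m - i) = (2 * (m - i.+1)).+2)%N; last by lia.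
Qed.

Lemma polyDelta_chain (R : realType) (m : nat) (alpha : R) (v : R -> R) :
  tame_at0 (2 * m) 0 v ->
  radial_chain m alpha (fun i => polyDelta i alpha v) (polyflux alpha v).
Proof.
move=> hv i im r r0.
have := polyDelta_tame alpha hv (ltnW im).
rewrite (_ : 2 * (m - i) = (2 * (m - i.+1)).+2)%N; last by lia.
move=> [du _ [ddu _ _]]; split.
  apply: is_derive_eq (is_derive_derive1 (du r r0)) _.
  by rewrite /polyflux mulrA powRVK// mul1r.
have dw : derivable (polyflux alpha v i) r 1.
  have := is_deriveM (is_derive1_powR alpha r0) (is_derive_derive1 (ddu r r0)).
  by case.
apply: is_derive_eq (is_derive_derive1 dw) _.
rewrite /= /Delta -/(polyflux alpha v i) mulrN opprK mulrA.
by rewrite [_ `^ alpha * _]mulrC powRVK// mul1r.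
Qed.

(** The flux of level i is O(r^(alpha - 2i - 1)) with 2i + 1 <= 2m - 1 < alpha. *)
Lemma polyflux_cvg0 (R : realType) (m : nat) (alpha : R) (v : R -> R) :
  0 < alpha - 2 * m%:R + 1 -> tame_at0 (2 * m) 0 v ->
  forall i, (i < m)%N -> polyflux alpha v i r @[r --> 0^'+] --> (0 : R).
Proof.
move=> ham hv i im.
have := polyDelta_tame alpha hv (ltnW im).
rewrite (_ : 2 * (m - i) = (2 * (m - i.+1)).+2)%N; last by lia.
move=> [_ _ [_ [C [d [d0 hC]]] _]].
have am : (i%:R + 1 : R) <= m%:R by rewrite natr1 ler_nat.
apply: (@cvg_right0_pow R _ (alpha - (2 * i).+1%:R) C d _ d0).
  by rewrite -natr1 natrM; lra.
move=> r r0 rd; rewrite /polyflux normrM ger0_norm ?powR_ge0//.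
rewrite powRD_pos// powRN powR_mulrn ?(ltW r0)// mulrCA ler_wpM2l ?powR_ge0//.
by rewrite ler_pdivlMr ?exprn_gt0// hC.
Qed.

(** * Integrability, positivity and comparison with powers *)

(** The mass of |u|^2 r^(kappa - 1) on (r, 2r] tends to 0, tested on constant lower
    bounds c of |u| only. *)
Definition dyadic_tail_small (R : realType) (kappa : R) (u : R -> R) : Prop :=
  forall eta, 0 < eta -> exists2 T, 0 < T & forall r c, T <= r -> 0 <= c ->
    (forall s, r < s -> s <= 2 * r -> c <= `|u s|) -> c ^+ 2 * r `^ kappa <= eta.

(** The integral over (0, r] increases to a finite limit, so its increments over
    (r, 2r] tend to 0. *)
Lemma wL2_dyadic_tail_small (R : realType) (theta : R) (v : R -> R) :
  0 <= theta + 1 -> in_wL2 theta v -> dyadic_tail_small (theta + 1) v.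
Proof.
move=> th1 [mv hv] eta eta0.
pose f (s : R) := (`|v s| ^+ 2 * s `^ theta)%:E.
have f0 s : (0 <= f s)%E by rewrite lee_fin mulr_ge0 ?powR_ge0// exprn_ge0.
have mf : measurable_fun (halfline R) f.
  apply/measurable_EFinP; apply: measurable_funM.
    by apply: measurable_funX; exact: measurableT_comp.
  exact: measurable_funS (measurable_powR theta).
have mH : measurable (halfline R) by exact: measurable_itv.
have sub (a b : R) : 0 <= a -> (`]a, b]%classic : set R) `<=` halfline R.
  move=> a0 x /=; rewrite in_itv /= => /andP[ax _].
  by rewrite /halfline /= in_itv /= andbT (le_lt_trans a0).
pose J (a b : R) := (\int[lebesgue_measure]_(s in (`]a, b]%classic : set R)) f s)%E.
have J0 a b : (0 <= J a b)%E by apply: integral_ge0 => x _; exact: f0.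
pose I := (\int[lebesgue_measure]_(s in halfline R) f s)%E.
have Ioo : (I < +oo)%E by apply: (@lty_poweRy _ _ 2^-1); [rewrite invr_eq0|exact: hv].
have JI r : (J 0%R r <= I)%E.
  by apply: ge0_subset_integral => //; exact: sub.
have Jfin r : J 0 r \is a fin_num.
  by rewrite ge0_fin_numE//; exact: le_lt_trans (JI r) Ioo.
have split r : 0 < r -> J 0 (2 * r) = (J 0%R r + J r (2 * r)%R)%E.
  move=> r0; have e : `]0%R, (2 * r)%R]%classic = `]0%R, r]%classic `|` `]r, (2 * r)%R]%classic.
    by apply: itv_bndbnd_setU; rewrite bnd_simp; lra.
  rewrite /J e ge0_integral_setU//.
  - by rewrite -e; apply: measurable_funS mf => //; exact: sub.
  - apply/disj_setPS => x [/=]; rewrite !in_itv /= => /andP[_ h1] /andP[h2 _].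
    by move: (lt_le_trans h2 h1); rewrite ltxx.
pose E := [set fine (J 0 r) | r in [set r : R | 0 < r]].
have supE : has_sup E.
  split; first by exists (fine (J 0 1)); exists 1 => //=.
  exists (fine I) => _ [r r0 <-]; apply: fine_le (JI r) => //.
  by rewrite ge0_fin_numE//; apply: integral_ge0 => x _; exact: f0.
have [|_ [r0 r00 <-] hr0] := @sup_adherent R E (eta / 2) _ supE; first by rewrite divr_gt0.
exists r0 => // r c r0r c0 hc; have rp : 0 < r := lt_le_trans r00 r0r.
have h1 : fine (J 0 r0) <= fine (J 0 r).
  apply: fine_le => //; apply: ge0_subset_integral => //.
    by apply: measurable_funS mf => //; exact: sub.
  by apply: subset_itvl; rewrite bnd_simp.
have h2 : fine (J 0 (2 * r)) <= sup E.
  by apply: ub_le_sup => //; [case: supE|exists (2 * r) => //=; rewrite mulr_gt0].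
have Jr : J r (2 * r) \is a fin_num.
  have := Jfin (2 * r); rewrite split// fin_numD => /andP[].
  by [].
move: h2; rewrite split// fineD// => h2.
have h3 : ((c ^+ 2 * r `^ (theta + 1) / 2)%:E <= J r (2 * r)%R)%E.
  pose k := c ^+ 2 * (r `^ (theta + 1) / (2 * r)).
  have -> : (c ^+ 2 * r `^ (theta + 1) / 2)%:E =
      (\int[lebesgue_measure]_(s in `]r, (2 * r)%R]%classic) (cst k%:E) s)%E.
    rewrite integral_cst//= lebesgue_measure_itv/= lte_fin ifT; last by lra.
    by rewrite -EFinB -EFinM /k; congr (_%:E); field; lra.
  apply: ge0_le_integral => //.
  - move=> x _; rewrite lee_fin /k mulr_ge0 ?sqr_ge0// divr_ge0 ?powR_ge0//; lra.
  - by apply: measurable_funS mf => //; apply: sub; exact: ltW.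
  - move=> s /=; rewrite in_itv /= => /andP[rs sr].
    have s0 : 0 < s := lt_trans rp rs.
    rewrite lee_fin /k; apply: ler_pM.
    + by rewrite sqr_ge0.
    + by rewrite divr_ge0 ?powR_ge0//; lra.
    + by rewrite lerXn2r ?nnegrE// hc.
    have -> : s `^ theta = s `^ (theta + 1) / s.
      by rewrite -(powR_inv1 (ltW s0)) -powRD_pos// addrK.
    rewrite ler_pM ?powR_ge0 ?invr_ge0//; first by lra.
      by apply: ge0_ler_powR; rewrite ?nnegrE; lra.
    by rewrite lef_pV2 ?posrE; lra.
have := fine_le _ Jr h3; rewrite /= => /(_ isT); lra.
Qed.

Lemma tail_not_bounded_below (R : realType) (kappa : R) (u : R -> R) (b T : R) :
  0 < kappa -> dyadic_tail_small kappa u -> 0 < b ->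
  ~ (forall r, T <= r -> b <= `|u r|).
Proof.
move=> k0 hu b0 hb; have b2 : 0 < b ^+ 2 by rewrite exprn_gt0.
have [|S S0 hS] := hu (b ^+ 2 / 2); first by rewrite divr_gt0.
pose r := Num.max S (Num.max T 1).
have Sr : S <= r by rewrite le_max lexx.
have Tr : T <= r by rewrite !le_max lexx !orbT.
have r1 : 1 <= r by rewrite !le_max lexx !orbT.
have rk : 1 <= r `^ kappa by rewrite -(powRr0 r) ler_powR// ltW.
have H : b ^+ 2 * r `^ kappa <= b ^+ 2 / 2.
  by apply: hS (ltW b0) _ => // s rs _; apply: hb; lra.
have : b ^+ 2 * 1 <= b ^+ 2 * r `^ kappa by rewrite ler_wpM2l// ltW.
lra.
Qed.

(** Downward induction on i. If U (i+1) >= 0 then U i is nonincreasing; were its limit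
    not 0, [chain_blowup] would keep |U 0| away from 0 at infinity. *)
Lemma chain_nonneg_decay (R : realType) (m : nat) (alpha kappa : R) (U W : nat -> R -> R) :
  0 < alpha -> 0 < kappa -> radial_chain m alpha U W ->
  (forall i, (i < m)%N -> W i r @[r --> 0^'+] --> (0 : R)) ->
  dyadic_tail_small kappa (U 0%N) -> (forall r, 0 < r -> 0 <= U m r) ->
  (forall i, (i <= m)%N -> forall r, 0 < r -> 0 <= U i r) /\
  (forall i, (i < m)%N -> U i r @[r --> +oo] --> (0 : R)).
Proof.
move=> a0 k0 hU W0 tail Um.
have away i s c T : (i <= m)%N -> 0 < c -> `|s| <= 1 -> 0 < T ->
    ~ (forall r, T <= r -> c <= s * U i r).
  move=> im c0 s1 T0 h.
  have [b b0 [T' [s' [T'0 s's hb]]]] := chain_blowup a0 hU im c0 T0 h.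
  apply: (tail_not_bounded_below (T := T') k0 tail b0) => r rT.
  apply: le_trans (hb r rT) _; apply: le_trans (ler_norm _) _.
  by rewrite normrM ler_piMl// (le_trans s's).
have nonneg_decay i : (i < m)%N -> (forall r, 0 < r -> 0 <= U i.+1 r) ->
    (forall r, 0 < r -> 0 <= U i r) /\ (U i r @[r --> +oo] --> (0 : R)).
  move=> im Ui; have decr := radial_decr (hU i im) (W0 i im) Ui.
  have pos r : 0 < r -> 0 <= U i r.
    move=> r0; rewrite leNgt; apply/negP => ur.
    apply: (away i (-1) (- U i r) r (ltnW im) _ _ r0).
    - by rewrite oppr_gt0.
    - by rewrite normrN1.
    - by move=> x rx; rewrite mulN1r lerN2 decr.
  split=> //; apply/cvg_pinftyP => e e0; apply: contrapT => he.
  apply: (away i 1 e 1 (ltnW im) e0 _ ltr01); first by rewrite normr1.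
  move=> r r1; rewrite mul1r leNgt; apply/negP => ur; apply: he.
  have r0 : 0 < r by lra.
  exists r => // x rx; rewrite ger0_norm; last by apply: pos; lra.
  exact: le_lt_trans (decr r x r0 rx) ur.
have pos i : (i <= m)%N -> forall r, 0 < r -> 0 <= U i r.
  move=> im; rewrite -(subKn im); elim: (m - i)%N (leq_subr i m) => [|k IH] km.
    by rewrite subn0.
  have km' : (m - k.+1 < m)%N by lia.
  have h : forall r, 0 < r -> 0 <= U (m - k.+1).+1 r.
    by rewrite -subSn// subSS; apply: IH; exact: ltnW.
  exact: (nonneg_decay _ km' h).1.
by split=> [|i im]; [exact: pos|exact: (nonneg_decay _ im (pos _ im)).2].
Qed.

(** For a nonincreasing v, the value at r is a lower bound on (r/2, r]. *)
Lemma dyadic_tail_small_le (R : realType) (g eta : R) (v : R -> R) :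
  0 < g -> dyadic_tail_small (2 * g) v -> (forall r, 0 < r -> 0 <= v r) ->
  (forall x y, 0 < x -> x <= y -> v y <= v x) -> 0 < eta ->
  exists2 T, 0 < T & forall r, T <= r -> v r <= eta * r `^ (- g).
Proof.
move=> g0 tail v0 decr e0.
have c0 : 0 < 2 `^ (2 * g) :> R by rewrite powR_gt0.
have [|T T0 hT] := tail (eta ^+ 2 / 2 `^ (2 * g)); first by rewrite divr_gt0 ?exprn_gt0.
exists (2 * T) => [|r Tr]; first by rewrite mulr_gt0.
have r0 : 0 < r by lra.
have : v r ^+ 2 * (r / 2) `^ (2 * g) <= eta ^+ 2 / 2 `^ (2 * g).
  apply: hT; [by lra|exact: v0|] => s rs sr.
  by rewrite (le_trans _ (ler_norm _))// decr; lra.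
have e2 : (r / 2) `^ (2 * g) * 2 `^ (2 * g) = r `^ (2 * g).
  rewrite -powRM ?ler0n//; last by rewrite divr_ge0// ltW.
  by rewrite divfK// pnatr_eq0.
rewrite ler_pdivlMr// -mulrA e2.
have -> : r `^ (2 * g) = (r `^ g) ^+ 2.
  by rewrite mulrC powRrM powR_mulrn// powR_ge0.
rewrite -exprMn ler_sqr ?nnegrE ?mulr_ge0 ?powR_ge0 ?v0 ?(ltW e0)//.
by rewrite powRN ler_pdivlMr ?powR_gt0.
Qed.

(** (-Delta_alpha)^i r^(-beta) = power_coef i * r^(-(beta + 2i)). *)
Definition power_coef (R : realType) (alpha beta : R) (i : nat) : R :=
  \prod_(l < i) ((beta + 2 * l%:R) * (alpha - 1 - beta - 2 * l%:R)).

Definition power_level (R : realType) (alpha beta : R) (i : nat) (r : R) : R :=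
  power_coef alpha beta i * r `^ (- (beta + 2 * i%:R)).

Definition power_flux (R : realType) (alpha beta : R) (i : nat) (r : R) : R :=
  - (beta + 2 * i%:R) * power_coef alpha beta i * r `^ (alpha - (beta + 2 * i%:R) - 1).

Lemma power_chain (R : realType) (m : nat) (alpha beta : R) :
  radial_chain m alpha (power_level alpha beta) (power_flux alpha beta).
Proof.
move=> i _ r r0; split.
  apply: is_derive_eq (is_derive_cpow _ _ r0) _.
  rewrite /power_flux [RHS]mulrCA -powRD_pos//.
  have -> : - alpha + (alpha - (beta + 2 * i%:R) - 1) = - (beta + 2 * i%:R) - 1 by ring.
  by ring.
apply: is_derive_eq (is_derive_cpow _ _ r0) _.
rewrite /power_level [r `^ alpha * _]mulrCA -powRD_pos//.
have -> : alpha + - (beta + 2 * i.+1%:R) = alpha - (beta + 2 * i%:R) - 1 - 1.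
  by rewrite -natr1; ring.
by rewrite /power_coef big_ord_recr /=; ring.
Qed.

Lemma power_coef_gt0 (R : realType) (m : nat) (alpha beta : R) :
  0 < beta -> beta + 2 * m%:R < alpha + 1 -> 0 < power_coef alpha beta m.
Proof.
move=> b0 bm; apply: prodr_gt0 => -[l lm] _ /=.
have l0 := ler0n R l; have : (l%:R + 1 : R) <= m%:R by rewrite natr1 ler_nat.
by move=> lm1; rewrite mulr_gt0//; lra.
Qed.

Lemma power_flux_cvg0 (R : realType) (m : nat) (alpha beta : R) i :
  beta + 2 * m%:R < alpha + 1 -> (i < m)%N ->
  power_flux alpha beta i r @[r --> 0^'+] --> (0 : R).
Proof.
move=> bm im; have : (i%:R + 1 : R) <= m%:R by rewrite natr1 ler_nat.
move=> i1; pose c := - (beta + 2 * i%:R) * power_coef alpha beta i.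
apply: (@cvg_right0_pow R _ (alpha - (beta + 2 * i%:R) - 1) `|c| 1) => // [|r r0 _].
  by lra.
by rewrite normrM (ger0_norm (powR_ge0 _ _)).
Qed.

Lemma power_level_cvg_pinfty (R : realType) (alpha beta : R) i : 0 < beta ->
  power_level alpha beta i r @[r --> +oo] --> (0 : R).
Proof.
move=> b0; apply: (@cvg_pinfty_pow R _ (beta + 2 * i%:R) `|power_coef alpha beta i| 1).
  by have := ler0n R i; lra.
by move=> r r1; rewrite normrM (ger0_norm (powR_ge0 _ _)).
Qed.

Lemma cvg0_comb (R : realType) (F : set_system R) (FF : Filter F) (a b : R) (f g : R -> R) :
  f r @[r --> F] --> (0 : R) -> g r @[r --> F] --> (0 : R) ->
  (a * f r + b * g r) @[r --> F] --> (0 : R).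
Proof.
move=> f0 g0; rewrite -[X in _ --> X](_ : a * 0 + b * 0 = 0); last by ring.
by apply: cvgD; apply: cvgM => //; exact: cvg_cst.
Qed.

(** The right-hand side is U 0 for a chain of powers whose top level is the bound on
    U m; the maximum principle [chain_nonneg] compares the two chains. *)
Lemma potential_bound (R : realType) (m : nat) (alpha b g A E : R) (U W : nat -> R -> R) :
  0 < b -> b + 2 * m%:R < alpha + 1 -> 0 < g -> g + 2 * m%:R < alpha + 1 ->
  radial_chain m alpha U W ->
  (forall i, (i < m)%N -> W i r @[r --> 0^'+] --> (0 : R)) ->
  (forall i, (i < m)%N -> U i r @[r --> +oo] --> (0 : R)) ->
  (forall r, 0 < r -> U m r <= A * r `^ (- (b + 2 * m%:R)) + E * r `^ (- (g + 2 * m%:R))) ->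
  forall r, 0 < r ->
    U 0%N r <= A / power_coef alpha b m * r `^ (- b) + E / power_coef alpha g m * r `^ (- g).
Proof.
move=> b0 bm g0 gm hU W0 Uoo hm r r0.
have kb := power_coef_gt0 b0 bm; have kg := power_coef_gt0 g0 gm.
pose A' := A / power_coef alpha b m; pose E' := E / power_coef alpha g m.
pose X i r := 1 * (A' * power_level alpha b i r + E' * power_level alpha g i r) + -1 * U i r.
pose Y i r := 1 * (A' * power_flux alpha b i r + E' * power_flux alpha g i r) + -1 * W i r.
have hX : radial_chain m alpha X Y.
  move=> i im; apply: radial_step_comb (hU i im); apply: radial_step_comb.
    exact: (@power_chain R m).
  exact: (@power_chain R m).
have := chain_nonneg hX _ _ _ (leq0n m) r0.
have -> : X 0%N r = A' * r `^ (- b) + E' * r `^ (- g) - U 0%N r.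
  by rewrite /X /power_level /power_coef !big_ord0 !mulr0 !addr0; ring.
rewrite -/A' -/E' subr_ge0; apply.
- move=> i im; apply: cvg0_comb (W0 i im); apply: cvg0_comb.
    exact: power_flux_cvg0 bm im.
  exact: power_flux_cvg0 gm im.
- move=> i im; apply: cvg0_comb (Uoo i im).
  by apply: cvg0_comb; exact: power_level_cvg_pinfty.
- move=> x x0; have := hm x x0; rewrite /X /power_level /A' /E' !mulrA !divfK ?gt_eqF//.
  by rewrite !mulN1r mul1r subr_ge0.
Qed.

(** * The decay rate of a solution *)

(** Far out u^q <= eta' r^(-2m) with eta' as small as desired, since u = o(r^(-g)) and
    q g = 2m. Hence a bound u <= A r^(-b) + E r^(-g), inserted in U m = u^q u and
    integrated by [potential_bound], comes back with E halved. The term B accounts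
    for bounded r, and A = 2 B / kb' is a fixed point of the iteration. *)
Lemma critical_decay (R : realType) (m : nat) (alpha g q b C0 : R) (U W : nat -> R -> R) :
  0 < g -> g + 2 * m%:R < alpha + 1 -> 0 < b -> b + 2 * m%:R < alpha + 1 ->
  0 < q -> q * g = 2 * m%:R -> radial_chain m alpha U W ->
  (forall i, (i < m)%N -> W i r @[r --> 0^'+] --> (0 : R)) ->
  (forall i, (i < m)%N -> U i r @[r --> +oo] --> (0 : R)) ->
  (forall r, 0 < r -> 0 <= U 0%N r) -> (forall r, 0 < r -> U 0%N r <= C0) ->
  (forall eta, 0 < eta ->
     exists2 T, 0 < T & forall r, T <= r -> U 0%N r <= eta * r `^ (- g)) ->
  (forall r, 0 < r -> U m r = U 0%N r `^ q * U 0%N r) ->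
  exists2 A, 0 <= A & forall r, 0 < r -> U 0%N r <= A * r `^ (- b).
Proof.
move=> g0 gm b0 bm q0 qg hU W0 Uoo U0 UC small Um.
have kb := power_coef_gt0 b0 bm; have kg := power_coef_gt0 g0 gm.
set kb' := power_coef alpha b m in kb; set kg' := power_coef alpha g m in kg.
have C00 : 0 <= C0 by apply: le_trans (UC 1 ltr01); exact: U0.
(* eta' absorbs the constants lost in integrating either power *)
pose eta' := Num.min kb' kg' / 2.
have eta'0 : 0 < eta' by rewrite divr_gt0// lt_min kb.
have eb : eta' / kb' <= 2^-1.
  by rewrite ler_pdivrMr// mulrC /eta' ler_wpM2r ?invr_ge0// ge_min lexx.
have eg : eta' / kg' <= 2^-1.
  by rewrite ler_pdivrMr// mulrC /eta' ler_wpM2r ?invr_ge0// ge_min lexx orbT.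
have [|T T0 hT] := small (eta' `^ q^-1); first exact: powR_gt0.
have [T1 T10 hT1] := small 1 ltr01.
pose E0 := 1 + C0 * T1 `^ g.
have hE0 r : 0 < r -> U 0%N r <= E0 * r `^ (- g).
  move=> r0; have [T1r|rT1] := leP T1 r.
    apply: le_trans (hT1 r T1r) _; rewrite ler_wpM2r ?powR_ge0//.
    by rewrite lerDl mulr_ge0// powR_ge0.
  apply: le_trans (UC r r0) _; rewrite powRN ler_pdivlMr ?powR_gt0//.
  have : C0 * r `^ g <= C0 * T1 `^ g.
    by rewrite ler_wpM2l//; apply: ge0_ler_powR; rewrite ?nnegrE; lra.
  by rewrite /E0; lra.
pose B := C0 `^ q * C0 * T `^ (b + 2 * m%:R).
have B0 : 0 <= B by rewrite !mulr_ge0 ?powR_ge0.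
pose A := 2 * B / kb'.
have A0 : 0 <= A by apply: divr_ge0; [rewrite mulr_ge0|exact: ltW].
have E00 : 0 <= E0 by rewrite addr_ge0// mulr_ge0// powR_ge0.
have H n : forall r, 0 < r -> U 0%N r <= A * r `^ (- b) + E0 / 2 ^+ n * r `^ (- g).
  elim: n => [|n IH] r r0.
    rewrite expr0 divr1; apply: le_trans (hE0 r r0) _.
    by rewrite lerDr mulr_ge0// powR_ge0.
  set E := E0 / 2 ^+ n in IH *.
  have E_0 : 0 <= E by rewrite divr_ge0// exprn_ge0.
  have hm x : 0 < x -> U m x <= (B + eta' * A) * x `^ (- (b + 2 * m%:R)) +
      (eta' * E) * x `^ (- (g + 2 * m%:R)).
    move=> x0; rewrite Um//; have [Tx|xT] := leP T x.
      have h1 : U 0%N x `^ q <= eta' * x `^ (- (2 * m%:R)).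
        apply: (@le_trans _ _ ((eta' `^ q^-1 * x `^ (- g)) `^ q)).
          apply: ge0_ler_powR; rewrite ?(ltW q0) ?nnegrE ?U0 ?mulr_ge0 ?powR_ge0//.
          exact: hT.
        rewrite powRM ?powR_ge0// -!powRrM mulVf ?gt_eqF// powRr1 ?(ltW eta'0)//.
        by rewrite mulNr [g * q]mulrC qg.
      apply: le_trans (ler_pM (powR_ge0 _ _) (U0 x x0) h1 (IH x x0)) _.
      rewrite !opprD !powRD_pos//.
      set xb := x `^ (- b); set xg := x `^ (- g); set xm := x `^ (- (2 * m%:R)).
      have : 0 <= B * (xb * xm) by rewrite !mulr_ge0 ?powR_ge0.
      lra.
    have h1 : U 0%N x `^ q * U 0%N x <= B * x `^ (- (b + 2 * m%:R)).
      rewrite powRN ler_pdivlMr ?powR_gt0//; apply: ler_pM; rewrite ?mulr_ge0 ?powR_ge0 ?U0//.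
        apply: ler_pM; rewrite ?powR_ge0 ?U0 ?UC//.
        by apply: ge0_ler_powR; rewrite ?nnegrE ?(ltW q0) ?U0 ?UC.
      have := ler0n R m; move=> mn.
      by apply: ge0_ler_powR; rewrite ?nnegrE; lra.
    apply: (le_trans h1).
    have : 0 <= eta' * A * x `^ (- (b + 2 * m%:R)).
      by rewrite mulr_ge0 ?powR_ge0// mulr_ge0// ltW.
    have : 0 <= eta' * E * x `^ (- (g + 2 * m%:R)).
      by rewrite mulr_ge0 ?powR_ge0// mulr_ge0// ltW.
    lra.
  have := potential_bound b0 bm g0 gm hU W0 Uoo hm r0.
  rewrite -/kb' -/kg' => /le_trans; apply; apply: lerD.
    rewrite ler_wpM2r ?powR_ge0// mulrDl.
    have -> : eta' * A / kb' = eta' / kb' * A by ring.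
    have : eta' / kb' * A <= 2^-1 * A by rewrite ler_wpM2r.
    have e : 2 * (B / kb') = A by rewrite /A mulrA.
    lra.
  rewrite ler_wpM2r ?powR_ge0//.
  have -> : E0 / 2 ^+ n.+1 = 2^-1 * E by rewrite /E exprS invfM; ring.
  have -> : eta' * E / kg' = eta' / kg' * E by ring.
  by rewrite ler_wpM2r.
exists A => // r r0; rewrite leNgt; apply/negP => hr.
have [||n] := @exists_half_pow_lt R (E0 * r `^ (- g)) (U 0%N r - A * r `^ (- b)).
- by rewrite mulr_ge0// powR_ge0.
- by rewrite subr_gt0.
by have := H n r r0; rewrite mulrAC; lra.
Qed.

Lemma pow_superlinear_lipschitz (R : realType) (q M x y : R) :
  0 < q -> 0 < x -> 0 < y -> x <= M -> y <= M ->
  `|x `^ q * x - y `^ q * y| <= (q + 1) * M `^ q * `|x - y|.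
Proof.
move=> q0; wlog yx : x y / y <= x => [H x0 y0 xM yM|x0 y0 xM yM].
  have [yx|/ltW xy] := leP y x; first exact: H.
  by rewrite distrC [`|x - y|]distrC; exact: H.
have e (t : R) : 0 < t -> t `^ q * t = t `^ (q + 1).
  by move=> t0; rewrite powRD_pos// powRr1// ltW.
rewrite !e//.
have D (t : R) : 0 < t -> is_derive t (1 : R) (fun t => t `^ (q + 1)) ((q + 1) * t `^ q).
  by move=> t0; apply: is_derive_eq (is_derive1_powR (q + 1) t0) _; rewrite addrK.
apply: (le_trans (increment_abs_le y0 yx D
   (fun t _ => is_derive_lin ((q + 1) * M `^ q) t) _)).
  move=> t yt tx; rewrite normrM (ger0_norm (powR_ge0 _ _)) ger0_norm; last by lra.
  by rewrite ler_wpM2l; [| lra | apply: ge0_ler_powR; rewrite ?nnegrE; lra].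
by rewrite -mulrBr ger0_norm// subr_ge0.
Qed.

Lemma pow_superlinear_sign (R : realType) (q s x y : R) :
  0 < q -> 0 < x -> 0 < y -> 0 < s * (x - y) ->
  0 < s * (x `^ q * x - y `^ q * y).
Proof.
move=> q0 x0 y0.
have mono a b : 0 < a -> a < b -> a `^ q * a < b `^ q * b.
  move=> a0 ab; have b0 := lt_trans a0 ab; apply: ltr_pM; rewrite ?powR_ge0 ?(ltW a0)//.
  by apply: gt0_ltr_powR => //; rewrite nnegrE ltW.
have [s0|s0|->] := ltgtP s 0; last by rewrite mul0r ltxx.
- by rewrite !nmulr_rgt0// !subr_lt0; exact: mono.
- by rewrite !pmulr_rgt0// !subr_gt0; exact: mono.
Qed.

(** * Uniqueness by counting sign changes *)

(** What the solution and the bubble have in common: U 0 is positive, has the decay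
    rate b, and solves the critical equation with q = p - 1. *)
Definition ground_chain (R : realType) (m : nat) (alpha q b M : R)
    (U W : nat -> R -> R) : Prop :=
  [/\ radial_chain m alpha U W,
      (forall i, (i < m)%N -> W i r @[r --> 0^'+] --> (0 : R)),
      (forall i, (i < m)%N -> U i r @[r --> +oo] --> (0 : R)) &
      [/\ (forall r, 0 < r -> 0 < U 0%N r),
          (forall r, 0 < r -> U m r = U 0%N r `^ q * U 0%N r),
          (forall r, 0 < r -> U 0%N r <= M) &
          (forall r, 1 <= r -> U 0%N r <= M * r `^ (- b))]].

(** The difference X of the two chains has as many alternations as desired if it is
    not 0, since t |-> t^(q+1) is increasing and X m therefore has the sign of X 0,
    whereas [finite_alternations] bounds their number. The condition
    (q + 1) b = alpha + 2m is the integrability required near infinity, and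
    2m < q b makes |X m| small compared with r^(-2m) |X 0| there. *)
Lemma ground_chain_unique (R : realType) (m : nat) (alpha q b M l : R)
    (U W U' W' : nat -> R -> R) :
  (0 < m)%N -> 1 <= alpha -> 0 < q -> 0 < b -> (q + 1) * b = alpha + 2 * m%:R ->
  2 * m%:R < q * b ->
  ground_chain m alpha q b M U W -> ground_chain m alpha q b M U' W' ->
  U 0%N r @[r --> 0^'+] --> l -> U' 0%N r @[r --> 0^'+] --> l ->
  forall r, 0 < r -> U 0%N r = U' 0%N r.
Proof.
move=> m0 al q0 b0 qb qb2 [hU W0 Uoo [Up Um UM Ub]] [hU' W0' Uoo' [Up' Um' UM' Ub']] Ul Ul'.
pose X i r := 1 * U i r + -1 * U' i r; pose Y i r := 1 * W i r + -1 * W' i r.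
have XE i r : X i r = U i r - U' i r by rewrite /X mul1r mulN1r.
have hX : radial_chain m alpha X Y.
  by move=> i im; exact: radial_step_comb (hU i im) (hU' i im).
have Y0 i : (i < m)%N -> Y i r @[r --> 0^'+] --> (0 : R).
  by move=> im; exact: cvg0_comb (W0 i im) (W0' i im).
have Xoo i : (i < m)%N -> X i r @[r --> +oo] --> (0 : R).
  by move=> im; exact: cvg0_comb (Uoo i im) (Uoo' i im).
have X0 : X 0%N r @[r --> 0^'+] --> (0 : R).
  have h := cvgB Ul Ul'; rewrite subrr in h.
  rewrite (_ : X 0%N = fun r => U 0%N r - U' 0%N r); first exact: h.
  by apply/funext => r; exact: XE.
have M0 : 0 <= M by apply: le_trans (UM 1 ltr01); rewrite ltW// Up.
have Xm r : 0 < r -> X m r = U 0%N r `^ q * U 0%N r - U' 0%N r `^ q * U' 0%N r.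
  by move=> r0; rewrite XE Um// Um'.
have [n hn] : exists n, forall s, ~ alternates (fun=> True) (X 0%N) s n 0.
  pose k := q * b - 2 * m%:R; have k0 : 0 < k by rewrite subr_gt0.
  have q1 : 0 <= q + 1 by lra.
  have small : ((q + 1) * M `^ q * r `^ (- k)) @[r --> +oo] --> (0 : R).
    apply: (@cvg_pinfty_pow R _ k ((q + 1) * M `^ q) 1 k0) => r r1.
    by rewrite ger0_norm// !mulr_ge0 ?powR_ge0.
  have half0 : 0 < 2^-1 :> R by rewrite invr_gt0.
  have [T T0 hT] := (cvg_pinftyP _).1 small _ half0.
  have T10 : 0 < Num.max 1 T by rewrite lt_max ltr01.
  apply: (@finite_alternations R m alpha ((q + 1) * M `^ q) M alpha (M `^ q * M) (Num.max 1 T)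
    X Y m0 al hX Y0) => //.
  - by rewrite mulr_ge0 ?powR_ge0.
  - move=> r r0; rewrite Xm// XE.
    by apply: pow_superlinear_lipschitz; rewrite ?Up ?Up' ?UM ?UM'.
  - move=> r r0; rewrite XE ler_norml.
    by move: (Up r r0) (Up' r r0) (UM r r0) (UM' r r0) => *; apply/andP; split; lra.
  - by rewrite mulr_ge0 ?powR_ge0.
  - move=> r; rewrite ge_max => /andP[r1 _]; have r0 : 0 < r by lra.
    have bnd (x : R) : 0 < x -> x <= M * r `^ (- b) ->
        0 <= x `^ q * x <= M `^ q * M * r `^ (- (alpha + 2 * m%:R)).
      move=> x0 xM; rewrite mulr_ge0 ?powR_ge0 ?(ltW x0)//=.
      have -> : M `^ q * M * r `^ (- (alpha + 2 * m%:R)) =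
          (M * r `^ (- b)) `^ q * (M * r `^ (- b)).
        rewrite powRM ?powR_ge0// -powRrM -qb.
        have -> : - ((q + 1) * b) = - b * q + - b by ring.
        by rewrite powRD_pos//; ring.
      apply: ler_pM; rewrite ?powR_ge0 ?(ltW x0)//.
      by apply: ge0_ler_powR; rewrite ?nnegrE ?(ltW q0) ?(ltW x0) ?mulr_ge0 ?powR_ge0.
    rewrite Xm// ler_norml.
    have /andP[h1 h2] := bnd _ (Up r r0) (Ub r r1).
    have /andP[h3 h4] := bnd _ (Up' r r0) (Ub' r r1).
    by apply/andP; split; lra.
  - move=> r; rewrite ge_max => /andP[r1 Tr]; have r0 : 0 < r by lra.
    rewrite Xm// XE.
    apply: (le_trans (pow_superlinear_lipschitz q0 (Up r r0) (Up' r r0) (Ub r r1) (Ub' r r1))).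
    rewrite ler_wpM2r// powRM ?powR_ge0// -powRrM.
    have -> : - b * q = - k + - (2 * m%:R) by rewrite /k; ring.
    rewrite powRD_pos// !mulrA ler_wpM2r ?powR_ge0//.
    by have := hT r Tr; rewrite ger0_norm; [exact: ltW|rewrite !mulr_ge0 ?powR_ge0].
move=> r r0; apply: contrapT => Ur.
have Xr : X 0%N r != 0 by rewrite XE subr_eq0; apply/eqP.
suff [s hs] : exists s, alternates (fun=> True) (X 0%N) s n.+1 0.
  by apply: (hn s); exact: alternates_prefix hs.
(* each n + 1 alternations of X 0 give n + 2 of X m, hence n + 2 of X 0 *)
elim: n {hn} => [|n [s IH]].
  exists (X 0%N r), r; split => //.
  by rewrite -expr2 lt_def sqrf_eq0 Xr sqr_ge0.
have h := chain_alternates_gain hX Y0 Xoo X0 m0 IH.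
exists (- s); rewrite -[- s]mul1r; apply: alternates_sign h => x s' x0 _ h; rewrite mul1r.
have [xx|xx|xx] := ltgtP (U 0%N x) (U' 0%N x); last first.
- by move: h; rewrite Xm// xx subrr mulr0 ltxx.
- have := pow_superlinear_sign q0 (Up x x0) (Up' x x0) (s := 1).
  rewrite !mul1r subr_gt0 => /(_ xx) p; move: h; rewrite Xm// pmulr_lgt0// => s'0.
  by rewrite XE mulr_gt0// subr_gt0.
- have := pow_superlinear_sign q0 (Up' x x0) (Up x x0) (s := 1).
  rewrite !mul1r subr_gt0 => /(_ xx) p; move: h.
  rewrite Xm// -opprB mulrN -mulNr pmulr_lgt0// => s'0.
  by rewrite XE -opprB mulrN -mulNr mulr_gt0// subr_gt0.
Qed.

Lemma Pconst_rising (R : realType) (m : nat) (alpha g : R) :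
  g = (alpha - 2 * m%:R + 1) / 2 -> Pconst m alpha = 4 ^+ m * rising g (2 * m).
Proof.
move=> eg; rewrite /Pconst big_mkord (_ : (4 : R) ^+ m = \prod_(k < 2 * m) 2).
  rewrite /rising -big_split; apply: eq_bigr => k _ /=.
  by rewrite eg; field.
by rewrite prodr_const card_ord exprM; congr (_ ^+ _); ring.
Qed.

Definition bubble_amp (R : realType) (m : nat) (alpha : R) : R :=
  Pconst m alpha `^ ((alpha - 2 * m%:R + 1) / (4 * m%:R)).

Lemma bubbleE (R : realType) (m : nat) (alpha g eps r : R) :
  g = (alpha - 2 * m%:R + 1) / 2 -> 0 < eps ->
  bubble m alpha eps r = bubble_amp m alpha * eps `^ g * bubble_level m g eps 0 r.
Proof.
move=> eg e0; have q0 := quad_gt0 r e0.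
rewrite /bubble -eg -/(bubble_amp m alpha) bubble_level0 -mulrA; congr (_ * _).
rewrite powRM ?invr_ge0 ?(ltW e0) ?(ltW q0)//; congr (_ * _).
by rewrite -powR_inv1 ?(ltW q0)// -powRrM mulN1r.
Qed.

Lemma Pconst_gt0 (R : realType) (m : nat) (alpha : R) :
  0 < alpha - 2 * m%:R + 1 -> 0 < Pconst m alpha.
Proof.
move=> h; rewrite /Pconst big_mkord; apply: prodr_gt0 => k _.
by have := ler0n R k; lra.
Qed.

(** The amplitude of the bubble is the one for which amplitude^q is the constant
    Pconst = 4^m g (g+1) ... (g+2m-1) produced by the 2m differentiations. *)
Lemma bubble_solves (R : realType) (m : nat) (alpha g q eps r : R) :
  (0 < m)%N -> 0 < g -> g = (alpha - 2 * m%:R + 1) / 2 -> q * g = 2 * m%:R -> 0 < eps ->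
  bubble_amp m alpha * eps `^ g * bubble_level m g eps m r =
  (bubble_amp m alpha * eps `^ g * bubble_level m g eps 0 r) `^ q *
  (bubble_amp m alpha * eps `^ g * bubble_level m g eps 0 r).
Proof.
move=> m0 g0 eg qg e0; have q0 := quad_gt0 r e0.
have mn0 : (m%:R : R) != 0 by rewrite pnatr_eq0 -lt0n.
have P0 : 0 < Pconst m alpha by apply: Pconst_gt0; lra.
have amp : bubble_amp m alpha `^ q = Pconst m alpha.
  rewrite /bubble_amp -powRrM.
  have -> : (alpha - 2 * m%:R + 1) / (4 * m%:R) * q = 1.
    have -> : (alpha - 2 * m%:R + 1) / (4 * m%:R) * q = q * g / (2 * m%:R).
      by rewrite eg; field.
    by rewrite qg divff// mulf_neq0// pnatr_eq0.
  by rewrite powRr1// ltW.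
rewrite bubble_level0 bubble_level_last// !powRM ?mulr_ge0 ?powR_ge0// amp.
rewrite -!powRrM [g * q]mulrC qg mulNr [g * q]mulrC qg.
rewrite -natrM powR_mulrn ?(ltW e0)// (Pconst_rising eg) natrM.
by rewrite opprD powRD_pos//; ring.
Qed.

(** * Classification *)

Lemma bubble_level0_cvg (R : realType) (m : nat) (g eps : R) : 0 < eps ->
  bubble_level m g eps 0 r @[r --> 0^'+] --> (eps `^ (- (2 * g)) : R).
Proof.
move=> e0.
have -> : eps `^ (- (2 * g)) = bubble_level m g eps 0 0.
  rewrite bubble_level0 expr0n addr0 -powR_mulrn ?(ltW e0)// -powRrM.
  by congr (_ `^ _); ring.
rewrite (_ : bubble_level m g eps 0 = fun r => (eps ^+ 2 + r ^+ 2) `^ (- g)); last first.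
  by apply/funext => r; rewrite bubble_level0.
have [d _] := is_derive_quad_pow g 0 e0.
have c : {for 0, continuous (fun r : R => (eps ^+ 2 + r ^+ 2) `^ (- g))}.
  by apply: differentiable_continuous; exact/derivable1_diffP.
exact: cvg_at_right_filter c.
Qed.

Lemma bubble_ground_chain (R : realType) (m : nat) (alpha g q b eps : R) :
  (0 < m)%N -> 0 < g -> g = (alpha - 2 * m%:R + 1) / 2 -> q * g = 2 * m%:R ->
  0 < eps -> b <= 2 * g ->
  exists M, forall M', M <= M' -> ground_chain m alpha q b M'
    (fun i r => bubble_amp m alpha * eps `^ g * bubble_level m g eps i r)
    (fun i r => bubble_amp m alpha * eps `^ g * bubble_flux m alpha g eps i r).
Proof.
move=> m0 g0 eg qg e0 bg; set K := bubble_amp m alpha * eps `^ g.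
have P0 : 0 < Pconst m alpha by apply: Pconst_gt0; lra.
have K0 : 0 < K by rewrite mulr_gt0 ?powR_gt0.
have a1 : 0 < alpha + 1 by have := ler0n R m; lra.
have [C C0 hC] := bubble_level_decay m 0 e0 g0.
pose M1 := K * (eps ^+ 2) `^ (- g); pose M2 := K * C.
exists (Num.max M1 M2) => M; rewrite ge_max => /andP[M1M M2M]; split.
- by move=> i im; exact: radial_step_scale (bubble_chain e0 eg im).
- move=> i im; rewrite -[X in _ --> X](mulr0 K); apply: cvgM; first exact: cvg_cst.
  exact: bubble_flux_cvg0.
- move=> i im; rewrite -[X in _ --> X](mulr0 K); apply: cvgM; first exact: cvg_cst.
  have [C' C'0 hC'] := bubble_level_decay m i e0 g0.
  by apply: (cvg_pinfty_pow _ hC'); rewrite mulr_gt0.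
split.
- by move=> r r0; rewrite mulr_gt0// bubble_level0 powR_gt0// quad_gt0.
- by move=> r r0; exact: bubble_solves.
- move=> r r0; apply: le_trans M1M; rewrite /M1 ler_wpM2l ?(ltW K0)// bubble_level0.
  rewrite !powRN lef_pV2 ?posrE ?powR_gt0 ?quad_gt0 ?exprn_gt0//.
  apply: ge0_ler_powR; rewrite ?(ltW g0) ?nnegrE ?sqr_ge0//; last by rewrite lerDl sqr_ge0.
  by rewrite ltW// quad_gt0.
- move=> r r1; apply: (@le_trans _ _ (M2 * r `^ (- b))); last first.
    by rewrite ler_wpM2r ?powR_ge0.
  rewrite /M2 -mulrA ler_wpM2l ?(ltW K0)//.
  apply: le_trans (ler_norm _) _; apply: le_trans (hC r r1) _.
  by rewrite ler_wpM2l// ler_powR// lerN2.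
Qed.

Theorem theorem1p2 (R : realType) (m : nat) (alpha : R) (v : R -> R)
  (hm : (1 <= m)%N)
  (halpha : -1 < alpha)
  (hcrit : 0 < alpha - 2 * m%:R + 1)
  (hD : Dspace m alpha v)
  (hC : Ck (2 * m) v)
  (hpos : forall r : R, 0 < r -> 0 < v r)
  (heq : forall r : R, 0 < r ->
     polyDelta m alpha v r = `|v r| `^ (crit_exp m alpha - 2) * v r)
  (hns : nonsingular0 (2 * m - 1) v)
  (hodd : forall i : nat, odd i -> (i <= 2 * m - 1)%N -> deriv_at0 v i = 0) :
  exists2 eps : R, 0 < eps & forall r : R, 0 < r -> v r = bubble m alpha eps r.
Proof.
pose g : R := (alpha - 2 * m%:R + 1) / 2.
have g0 : 0 < g by rewrite divr_gt0.
have eg : g = (alpha - 2 * m%:R + 1) / 2 by [].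
have mR : (1 : R) <= m%:R by rewrite ler1n.
have ea : alpha = 2 * g + 2 * m%:R - 1 by rewrite eg; field.
have al1 : 1 <= alpha by lra.
pose q := crit_exp m alpha - 2.
have qg : q * g = 2 * m%:R.
  by rewrite /q /crit_exp eg; field; lra.
have q0 : 0 < q by have : 0 < q * g; [rewrite qg; lra|rewrite pmulr_lgt0].
(* b is smaller than the decay exponent 2 g of the bubble, yet large enough for
   v^p = O(r^(-(alpha + 2 m))), so that r^alpha (-Delta_alpha)^i (v - w) is integrable
   at infinity for every i >= 1 *)
pose b := g * (2 * g + 4 * m%:R - 1) / (2 * m%:R + g).
have d0 : 0 < 2 * m%:R + g by lra.
have b0 : 0 < b by rewrite /b divr_gt0// mulr_gt0//; lra.
have bg : b < 2 * g.
  rewrite /b ltr_pdivrMr//; have : g * (2 * g + 4 * m%:R - 1) < g * (2 * (2 * m%:R + g)).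
    by rewrite ltr_pM2l//; lra.
  lra.
have qb : (q + 1) * b = alpha + 2 * m%:R.
  have -> : q = 2 * m%:R / g by rewrite -qg mulfK// gt_eqF.
  by rewrite /b ea; field; rewrite !gt_eqF.
have qb2 : 2 * m%:R < q * b by lra.
have tame : tame_at0 (2 * m) 0 v by apply: tame_of_nonsingular hC _; rewrite -subn1.
have hV := polyDelta_chain alpha tame; set V := fun i => polyDelta i alpha v in hV.
have W0 : forall i, (i < m)%N -> polyflux alpha v i r @[r --> 0^'+] --> (0 : R).
  exact: polyflux_cvg0 hcrit tame.
have Vm r : 0 < r -> V m r = v r `^ q * v r.
  by move=> r0; rewrite /V heq// gtr0_norm// hpos.
have tail : dyadic_tail_small (2 * g) v.
  have -> : 2 * g = alpha - 2 * (m%:R - 0%:R) + 1 by rewrite eg; field.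
  case: hD => _ /(_ 0%N isT) hv _; apply: wL2_dyadic_tail_small hv.
  by rewrite subr0; lra.
have Vm0 r : 0 < r -> 0 <= V m r by move=> r0; rewrite Vm// mulr_ge0 ?powR_ge0// ltW// hpos.
have g2 : 0 < 2 * g by lra.
have [V0 Voo] := chain_nonneg_decay (lt_le_trans ltr01 al1) g2 hV W0 tail Vm0.
have decr := radial_decr (hV 0%N hm) (W0 0%N hm) (V0 1%N hm).
pose l : R := lim (v r @[r --> 0^'+]).
have vl : v r @[r --> 0^'+] --> l by exact: hns 0%N (leq0n _).
have vle r : 0 < r -> v r <= l + 1.
  move=> r0; have [x [x0 xr]] := cvg_right0_point vl ltr01 r0.
  rewrite ltr_norml => /andP[_ h]; have := decr x r x0 (ltW xr).
  by rewrite /V /=; lra.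
(* v is nonincreasing, so its limit at 0 is not below v 1 *)
have l0 : 0 < l.
  have v1 := hpos 1 ltr01; have v2 : 0 < v 1 / 2 by rewrite divr_gt0.
  have [x [x0 x1]] := cvg_right0_point vl v2 ltr01.
  rewrite ltr_norml => /andP[_ h]; have := decr x 1 x0 (ltW x1).
  by rewrite /V /=; lra.
have [A A0 hA] : exists2 A, 0 <= A & forall r, 0 < r -> v r <= A * r `^ (- b).
  apply: (critical_decay (C0 := l + 1) g0 _ b0 _ q0 qg hV W0 Voo (V0 0%N isT) vle _ Vm).
  - by rewrite ea; lra.
  - by rewrite ea; lra.
  - by move=> eta; exact: dyadic_tail_small_le g0 tail (V0 0%N isT) decr.
have amp0 : 0 < bubble_amp m alpha by rewrite powR_gt0 ?Pconst_gt0.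
(* the bubble takes the value bubble_amp * eps^(-g) at 0 *)
pose eps := (bubble_amp m alpha / l) `^ g^-1.
have e0 : 0 < eps by rewrite powR_gt0 ?divr_gt0.
have epsg : eps `^ g = bubble_amp m alpha / l.
  by rewrite -powRrM mulVf ?gt_eqF// powRr1// ltW// divr_gt0.
exists eps => // r r0; rewrite (bubbleE r eg e0).
have [M hM] := bubble_ground_chain hm g0 eg qg e0 (ltW bg).
pose M' := Num.max M (Num.max (l + 1) A).
have MM' : M <= M' by rewrite le_max lexx.
have lM' : l + 1 <= M' by rewrite !le_max lexx orbT.
have AM' : A <= M' by rewrite !le_max lexx !orbT.
have gV : ground_chain m alpha q b M' V (polyflux alpha v).
  split=> //; split=> //.
  - by move=> x x0; apply: le_trans lM'; exact: vle.
  - move=> x x1; have x0 : 0 < x by lra.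
    by apply: le_trans (hA x x0) _; rewrite ler_wpM2r ?powR_ge0.
have hl : bubble_amp m alpha * eps `^ g * bubble_level m g eps 0 x @[x --> 0^'+] --> l.
  have -> : l = bubble_amp m alpha * eps `^ g * eps `^ (- (2 * g)).
    rewrite -mulrA -powRD_pos// (_ : g + - (2 * g) = - g); last by ring.
    by rewrite powRN epsg invf_div mulrCA divff ?mulr1// gt_eqF.
  by apply: cvgM; [exact: cvg_cst|exact: bubble_level0_cvg].
exact: (ground_chain_unique hm al1 q0 b0 qb qb2 gV (hM M' MM') vl hl).
Qed.
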